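(* Let $(\alpha,u)$ be a twisted action of an amenable discrete group $\Gamma$ on a unital $C^*$-algebra $\mathscr{A}$ preserving a tracial state $\mathrm{tr}$ (i.e. $\mathrm{tr}\circ\alpha_s=\mathrm{tr}$ for all $s\in\Gamma$), and let $\mathscr{A}\rtimes_{\alpha,u}\Gamma$ be the maximal twisted crossed product $C^*$-algebra. Let $\mathcal{F}$ be the finite approximation system for the algebraic twisted crossed product $\mathscr{A}*\Gamma$ consisting of the left $\mathscr{A}$-modules $\sum_{s\in F}\mathscr{A}\bar s$ for $F$ ranging over the finite subsets of $\Gamma$. Then $\mathrm{rk}_{\mathrm{tr}_{\alpha,u}}(A)=(\mathrm{rk}_{\mathrm{tr}})_{\mathcal{F}}(A)$ for every $A\in M_{n,m}(\mathscr{A}*\Gamma)$.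
   Context: **Twisted crossed products.** $\Gamma$ is a discrete group with identity $e_\Gamma$. A twisted action of $\Gamma$ on a unital $C^*$-algebra $\mathscr{A}$ is a pair of maps $\alpha:\Gamma\to\mathrm{Aut}(\mathscr{A})$, $u:\Gamma\times\Gamma\to\mathrm{U}(\mathscr{A})$ (the unitary group) such that, for all $\gamma,s,t\in\Gamma$: $\alpha_{e_\Gamma}=\mathrm{id}$ and $u_{e_\Gamma,s}=u_{s,e_\Gamma}=1_{\mathscr{A}}$; $\alpha_s\alpha_t=\mathrm{Ad}(u_{s,t})\alpha_{st}$, where $\mathrm{Ad}(v)(a)=vav^*$; $\alpha_\gamma(u_{s,t})u_{\gamma,st}=u_{\gamma,s}u_{\gamma s,t}$. The $*$-algebra $\mathscr{A}*\Gamma$ consists of finitely supported functions $\Gamma\to\mathscr{A}$, written $\sum_{s}f_s\bar s$, with pointwise addition, multiplication $(\sum_sf_s\bar s)(\sum_tg_t\bar t)=\sum_{s,t}f_s\alpha_s(g_t)u_{s,t}\overline{st}$ and involution $(\sum_sf_s\bar s)^*=\sum_su_{s^{-1},s}^*\alpha_{s^{-1}}(f_s^* )\overline{s^{-1}}$. $\mathscr{A}$ is identified with $\mathscr{A}\,\overline{e_\Gamma}$. $\mathscr{A}\rtimes_{\alpha,u}\Gamma$ is the completion of $\mathscr{A}*\Gamma$ under the norm $\|f\|=\sup_\pi\|\pi(f)\|$, $\pi$ ranging over all unital $*$-representations of $\mathscr{A}*\Gamma$ on Hilbert spaces. There is a unique unital positive linear map $\mathcal{E}:\mathscr{A}\rtimes_{\alpha,u}\Gamma\to\mathscr{A}$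 with $\mathcal{E}(a\overline{e_\Gamma})=a$ and $\mathcal{E}(a\bar s)=0$ for $a\in\mathscr{A}$, $s\ne e_\Gamma$. Put $\mathrm{tr}_{\alpha,u}:=\mathrm{tr}\circ\mathcal{E}$, which is a tracial state of $\mathscr{A}\rtimes_{\alpha,u}\Gamma$. **Rank function from a tracial state.** For a tracial state $\tau$ on a unital $C^*$-algebra $\mathscr{B}$, let $\pi_\tau$ be the GNS representation on $L^2(\mathscr{B},\tau)$ with canonical cyclic vector $\xi_\tau$, $\mathscr{B}''_\tau$ the von Neumann algebra generated by $\pi_\tau(\mathscr{B})$, $\tau''(T)=\langle T\xi_\tau,\xi_\tau\rangle$ the induced tracial state on $\mathscr{B}''_\tau$, extended to $M_n(\mathscr{B}''_\tau)$ by $\tau''(T)=\sum_{j}\tau''(T_{jj})$. For $A\in M_{n,m}(\mathscr{B})$ let $P$ be the orthogonal projection of $L^2(\mathscr{B},\tau)^{n\times1}$ (column vectors) onto the closure of $\pi_\tau(A)\cdot L^2(\mathscr{B},\tau)^{m\times1}$; $P\in M_n(\mathscr{B}''_\tau)$, and $\mathrm{rk}_\tau(A):=\tau''(P)$. This is a Sylvester matrix rank function for $\mathscr{B}$ (nonnegative, $\mathrm{rk}(0)=0$, $\mathrm{rk}(1)=1$, $\mathrm{rk}(AB)\le\min(\mathrm{rk}A,\mathrm{rk}B)$, additive on block diagonal matrices, and $\mathrm{rk}\begin{pmatrix}A&C\\0&B\end{pmatrix}\ge\mathrm{rk}A+\mathrm{rk}B$). In particular one has $\mathrm{rk}_{\mathrm{tr}}$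 on $\mathscr{A}$ and $\mathrm{rk}_{\mathrm{tr}_{\alpha,u}}$ on $\mathscr{A}\rtimes_{\alpha,u}\Gamma\supseteq\mathscr{A}*\Gamma$. **$(\mathrm{rk}_{\mathrm{tr}})_{\mathcal{F}}$.** Write $R=\mathscr{A}$, $S=\mathscr{A}*\Gamma$, $\mathrm{rk}=\mathrm{rk}_{\mathrm{tr}}$, and let $\hat{\mathcal{F}}$ be the set of nonzero members of $\mathcal{F}$; $\dim(\mathcal{W})$ is the rank of $\mathcal{W}\in\mathcal{F}$ as a free left $R$-module (so $\dim(\sum_{s\in F}\mathscr{A}\bar s)=|F|$). For $A\in M_{n,m}(S)$ and $\mathcal{W}\in\hat{\mathcal{F}}$, choose $\tilde{\mathcal{W}}\in\hat{\mathcal{F}}$ with $\mathcal{W}A_{i,j}\subseteq\tilde{\mathcal{W}}$ for all $i,j$, take $R$-bases $w_1,\dots,w_l$ of $\mathcal{W}^n$ and $\tilde w_1,\dots,\tilde w_p$ of $\tilde{\mathcal{W}}^m$ (row vectors), and let $B\in M_{l,p}(R)$ be determined by $w_iA=\sum_jB_{ij}\tilde w_j$; put $\mathrm{rk}_{\mathcal{W}}(A):=\mathrm{rk}(B)$, independent of the choices. $\mathcal{W}\in\hat{\mathcal{F}}$ is $(V,\varepsilon)$-invariant, for finite $V\subseteq S$ and $\varepsilon>0$, if $\dim(\tilde{\mathcal{W}})\le(1+\varepsilon)\dim(\mathcal{W})$ for some $\tilde{\mathcal{W}}\in\mathcal{F}$ containing $\mathcal{W}+\mathcal{W}V$ (where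 $\mathcal{W}V$ denotes finite sums of products $wv$). Such $\mathcal{W}$ always exist since $\Gamma$ is amenable. Fix an ultrafilter $\omega$ on $\hat{\mathcal{F}}$ containing, for each such $V,\varepsilon$, the set of $(V,\varepsilon)$-invariant $\mathcal{W}$. Then $\mathrm{rk}_{\mathcal{F}}(A):=\lim_{\mathcal{W}\to\omega}\mathrm{rk}_{\mathcal{W}}(A)/\dim(\mathcal{W})$; the value does not depend on $\omega$ and equals $\inf_{\mathcal{V}\in\hat{\mathcal{F}}}\mathrm{rk}_{\mathcal{V}}(A)/\dim(\mathcal{V})$. *)

(* Defs.v *)
From HB Require Import structures.
From mathcomp Require Import all_boot all_order all_algebra finmap.
From mathcomp Require Import complex.
From mathcomp Require Import all_classical all_reals topology normedtype.

Set Implicit Arguments.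
Unset Strict Implicit.
Unset Printing Implicit Defensive.

Import Order.TTheory GRing.Theory Num.Theory.
Import numFieldNormedType.Exports.

Local Open Scope classical_set_scope.
Local Open Scope complex_scope.
Local Open Scope ring_scope.

HB.mixin Record hasStar (C : numClosedFieldType) A of GRing.Algebra C A := {
  star : A -> A;
  starK : involutive star;
  starD : {morph star : x y / x + y};
  starZ : forall (c : C) x, star (c *: x) = (c^*)%R *: star x;
  starM : forall x y, star (x * y) = star y * star x
}.

#[short(type="starAlgType")]
HB.structure Definition StarAlgebra (C : numClosedFieldType) :=
  {A of GRing.Algebra C A & hasStar C A}.

(* The norm is an explicit real-valued function because Hierarchy Builder
   refuses a join of the library's rings and normed modules outside
   numDomainType. *)
HB.mixin Record isCStar (R : realType) A of StarAlgebra R[i] A := {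
  cnorm : A -> R;
  cnorm_eq0 : forall x : A, cnorm x = 0 -> x = 0;
  cnorm_triangle : forall x y : A, cnorm (x + y) <= cnorm x + cnorm y;
  cnormZ : forall (c : R[i]) (x : A),
    (cnorm (c *: x))%:C = `|c| * (cnorm x)%:C;
  cnormM_le : forall x y : A, cnorm (x * y) <= cnorm x * cnorm y;
  cnorm_star : forall x : A, cnorm (star x * x) = cnorm x ^+ 2;
  cnorm_complete : forall v : nat -> A,
    (forall e, 0 < e -> exists N, forall i j, (N <= i)%N -> (N <= j)%N ->
       cnorm (v i - v j) < e) ->
    exists l : A, forall e, 0 < e -> exists N, forall i, (N <= i)%N ->
       cnorm (v i - l) < e
}.

#[short(type="cstarAlgType")]
HB.structure Definition CStarAlgebra (R : realType) :=
  {A of StarAlgebra R[i] A & isCStar R A}.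

HB.mixin Record hasInner (R : realType) H of CompleteNormedModule R[i] H := {
  inner : H -> H -> R[i];
  innerDl : forall x y z, inner (x + y) z = inner x z + inner y z;
  innerZl : forall c x y, inner (c *: x) y = c * inner x y;
  innerC : forall x y, inner y x = ((inner x y)^*)%R;
  inner_norm : forall x : H, inner x x = `|x| ^+ 2
}.

#[short(type="hilbertType")]
HB.structure Definition Hilbert (R : realType) :=
  {H of CompleteNormedModule R[i] H & hasInner R H}.

Record starRep (R : realType) (S : starAlgType R[i]) (H : hilbertType R) := {
  rep :> S -> H -> H;
  rep_linear : forall f, linear (rep f);
  rep_continuous : forall f, continuous (rep f);
  repD : forall f g x, rep (f + g) x = rep f x + rep g x;
  repZ : forall c f x, rep (c *: f) x = c *: rep f x;
  rep1 : forall x, rep 1 x = x;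
  repM : forall f g x, rep (f * g) x = rep f (rep g x);
  rep_star : forall f x y, inner (rep f x) y = inner x (rep (star f) y)
}.

Definition opnorm (R : realType) (H : hilbertType R) (T : H -> H) : R :=
  sup [set complex.Re `|T x| | x in [set x | `|x| <= 1]].

Definition max_norm (R : realType) (S : starAlgType R[i]) (f : S) : R :=
  sup [set r | exists (H : hilbertType R) (pi : starRep S H),
    r = opnorm (pi f)].

Definition cpositive (C : numClosedFieldType) (A : starAlgType C) (a : A) :=
  exists b : A, a = star b * b.

Record tracial_state (C : numClosedFieldType) (A : starAlgType C)
    (tau : A -> C) : Prop := {
  trace_linear : scalar tau;
  trace_pos : forall a, cpositive a -> 0 <= tau a;
  trace1 : tau 1 = 1;
  traceC : forall a b, tau (a * b) = tau (b * a)
}.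

(* A GNS triple of [tau]; it is unique up to unitary equivalence. *)
Record gns (R : realType) (B : starAlgType R[i]) (tau : B -> R[i]) := {
  gns_space : hilbertType R;
  gns_rep : starRep B gns_space;
  gns_vec : gns_space;
  gns_state : forall b, inner (gns_rep b gns_vec) gns_vec = tau b;
  gns_cyclic : closure (range (fun b => gns_rep b gns_vec)) = [set: gns_space]
}.

Section Rank.
Variables (R : realType) (H : hilbertType R).

Definition cinner n (x y : 'cV[H]_n) : R[i] :=
  \sum_i inner (x i 0) (y i 0).

(* The orthogonal projection of H^n onto [M], when [M] is a closed subspace. *)
Definition orthproj n (M : set 'cV[H]_n) (v : 'cV[H]_n) : 'cV[H]_n :=
  xget 0 [set p | M p /\ forall w, M w -> cinner (v - p) w = 0].

Definition op_entry n (P : 'cV[H]_n -> 'cV[H]_n) (i j : 'I_n) (x : H) : H :=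
  P (\col_k (if k == j then x else 0)) i 0.

(* The projections used below have their entries in the von Neumann algebra
   generated by the representation; there, [vector_state] at the cyclic vector
   is the induced trace, and [vector_state_mx] its extension to matrices. *)
Definition vector_state (xi : H) (T : H -> H) : R[i] := inner (T xi) xi.

Definition vector_state_mx (xi : H) n (P : 'cV[H]_n -> 'cV[H]_n) : R[i] :=
  \sum_j vector_state xi (op_entry P j j).

Definition rep_mx (B : starAlgType R[i]) (pi : starRep B H) n m
    (A : 'M[B]_(n, m)) (v : 'cV[H]_m) : 'cV[H]_n :=
  \col_i \sum_j pi (A i j) (v j 0).

End Rank.

(* The complex number under [complex.Re] is real, being a sum of terms
   <P_jj xi, xi> with P a projection. *)
Definition vn_rank (R : realType) (B : starAlgType R[i]) (tau : B -> R[i])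
    (G : gns tau) n m (A : 'M[B]_(n, m)) : R :=
  complex.Re (vector_state_mx (gns_vec G)
    (orthproj (closure (range (rep_mx (gns_rep G) A))))).

Definition amenable (R : realType) (Gam : groupType) : Prop :=
  exists mu : set Gam -> R,
    [/\ forall X, 0 <= mu X,
        mu [set: Gam] = 1,
        forall X Y, X `&` Y = set0 -> mu (X `|` Y) = mu X + mu Y
      & forall s X, mu [set (s * x)%g | x in X] = mu X].

Record twistedAction (C : numClosedFieldType) (Gam : groupType)
    (A : starAlgType C) := TwistedAction {
  tal : Gam -> {lrmorphism A -> A};
  tu : Gam -> Gam -> A;
  tal_bij : forall s, bijective (tal s);
  tal_star : forall s a, tal s (star a) = star (tal s a);
  tu_unitaryl : forall s t, star (tu s t) * tu s t = 1;
  tu_unitaryr : forall s t, tu s t * star (tu s t) = 1;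
  tal1 : forall a, tal 1%g a = a;
  tu1l : forall s, tu 1%g s = 1;
  tu1r : forall s, tu s 1%g = 1;
  talM : forall s t a,
    tal s (tal t a) = tu s t * tal (s * t)%g a * star (tu s t);
  tu_cocycle : forall c s t,
    tal c (tu s t) * tu c (s * t)%g = tu c s * tu (c * s)%g t
}.

Definition tcp (C : numClosedFieldType) (Gam : groupType) (A : starAlgType C)
  (act : twistedAction Gam A) : Type := {fsfun Gam -> A with 0}.

Section StarTheory.
Variables (C : numClosedFieldType) (A : starAlgType C).
Lemma star0 : star (0 : A) = 0.
Proof. by apply: (addrI (star (0 : A))); rewrite -starD !addr0. Qed.
Lemma star1 : star (1 : A) = 1.
Proof. by rewrite -[LHS]mul1r -[X in X * _]starK -starM mul1r starK. Qed.
End StarTheory.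

Section TwistedCrossedProduct.
Local Open Scope fset_scope.
Local Open Scope ring_scope.
Variables (C : numClosedFieldType) (Gam : groupType) (A : starAlgType C).
Variable act : twistedAction Gam A.
Local Notation S := (tcp act).
Local Notation al := (tal act).
Local Notation u := (tu act).

HB.instance Definition _ := Choice.on S.

Implicit Types (f g h : S) (a b c : A) (s t r : Gam).

Definition tcoef f s : A := (f : {fsfun Gam -> A with 0}) s.
Definition tsupp f : {fset Gam} := finsupp (f : {fsfun Gam -> A with 0}).

Lemma tcpP f g : (forall s, tcoef f s = tcoef g s) -> f = g.
Proof. by move=> e; apply/fsfunP. Qed.

Lemma tsuppPn f s : s \notin tsupp f -> tcoef f s = 0.
Proof. exact: fsfun_dflt. Qed.

Definition tmk (X : {fset Gam}) (F : Gam -> A) : S :=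
  [fsfun s in X => F s | 0].

Lemma tmkE X F s : tcoef (tmk X F) s = if s \in X then F s else 0.
Proof. exact: fsfun_fun. Qed.

Definition tadd f g : S :=
  tmk (tsupp f `|` tsupp g) (fun s => tcoef f s + tcoef g s).
Definition topp f : S := tmk (tsupp f) (fun s => - tcoef f s).
Definition tscale (k : C) f : S := tmk (tsupp f) (fun s => k *: tcoef f s).
Definition tzero : S := tmk fset0 (fun=> 0).

Lemma taddE f g s : tcoef (tadd f g) s = tcoef f s + tcoef g s.
Proof.
rewrite tmkE inE; case: ifPn => //; rewrite negb_or => /andP[sf sg].
by rewrite !tsuppPn// addr0.
Qed.
Lemma toppE f s : tcoef (topp f) s = - tcoef f s.
Proof. by rewrite tmkE; case: ifPn => // sf; rewrite tsuppPn// oppr0. Qed.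
Lemma tscaleE k f s : tcoef (tscale k f) s = k *: tcoef f s.
Proof. by rewrite tmkE; case: ifPn => // sf; rewrite tsuppPn// scaler0. Qed.
Lemma tzeroE s : tcoef tzero s = 0.
Proof. by rewrite tmkE. Qed.

Fact taddA : associative tadd.
Proof. by move=> f g h; apply: tcpP => s; rewrite !taddE addrA. Qed.
Fact taddC : commutative tadd.
Proof. by move=> f g; apply: tcpP => s; rewrite !taddE addrC. Qed.
Fact tadd0 : left_id tzero tadd.
Proof. by move=> f; apply: tcpP => s; rewrite taddE tzeroE add0r. Qed.
Fact taddN : left_inverse tzero topp tadd.
Proof. by move=> f; apply: tcpP => s; rewrite taddE toppE tzeroE addNr. Qed.

HB.instance Definition _ := GRing.isZmodule.Build S taddA taddC tadd0 taddN.

Lemma tcoefD s : {morph tcoef^~ s : f g / f + g}.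
Proof. by move=> f g; exact: taddE. Qed.
Lemma tcoef0 s : tcoef 0 s = 0.
Proof. exact: tzeroE. Qed.
Lemma tcoef_sum I (l : seq I) (P : pred I) (F : I -> S) s :
  tcoef (\sum_(i <- l | P i) F i) s = \sum_(i <- l | P i) tcoef (F i) s.
Proof. exact: (big_morph _ (tcoefD s) (tcoef0 s)). Qed.

(* The element written a s^bar on paper: value a at s, 0 elsewhere. *)
Definition tsingle a s : S := tmk [fset s] (fun=> a).

Lemma tsingleE a s t : tcoef (tsingle a s) t = if t == s then a else 0.
Proof. by rewrite tmkE inE. Qed.
Lemma tsingleD s : {morph tsingle^~ s : a b / a + b}.
Proof.
move=> a b; apply: tcpP => t; rewrite tcoefD !tsingleE.
by case: ifP; rewrite ?addr0.
Qed.
Lemma tsingle0 s : tsingle 0 s = 0.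
Proof. by apply: tcpP => t; rewrite tcoef0 tsingleE; case: ifP. Qed.
Lemma tsupp_single a s : tsupp (tsingle a s) `<=` [fset s].
Proof. exact: finsupp_sub. Qed.

Lemma tcp_expand f : f = \sum_(s <- tsupp f) tsingle (tcoef f s) s.
Proof.
apply: tcpP => t; rewrite tcoef_sum.
under eq_bigr do rewrite tsingleE.
have [tf|tf] := boolP (t \in tsupp f); last first.
  rewrite tsuppPn// big_seq big1// => s sf.
  by case: eqP => // ts; rewrite ts sf in tf.
rewrite (big_fsetD1 t)//= eqxx big_seq big1 ?addr0// => s.
by rewrite !inE eq_sym => /andP[/negPf ->].
Qed.

Definition tone : S := tsingle 1 1%g.

Definition tmul f g : S :=
  \sum_(s <- tsupp f) \sum_(t <- tsupp g)
    tsingle (tcoef f s * al s (tcoef g t) * u s t) (s * t)%g.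

Definition tstar f : S :=
  \sum_(s <- tsupp f)
    tsingle (star (u s^-1%g s) * al s^-1%g (star (tcoef f s))) s^-1%g.

Lemma tsum_widen (X Y : {fset Gam}) (F : Gam -> S) : X `<=` Y ->
  (forall s, s \notin X -> F s = 0) ->
  \sum_(s <- X) F s = \sum_(s <- Y) F s.
Proof.
by move=> XY F0; apply: big_fset_incl => // s _; exact: F0.
Qed.

Lemma tmul_widen f g X Y : tsupp f `<=` X -> tsupp g `<=` Y ->
  tmul f g = \sum_(s <- X) \sum_(t <- Y)
    tsingle (tcoef f s * al s (tcoef g t) * u s t) (s * t)%g.
Proof.
move=> fX gY; rewrite /tmul (tsum_widen fX) => [|s /tsuppPn ->].
  by apply: eq_bigr => s _; apply: tsum_widen => // t /tsuppPn ->;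
    rewrite raddf0 mulr0 mul0r tsingle0.
by rewrite big1// => t _; rewrite !mul0r tsingle0.
Qed.

Let hull f g := tsupp f `|` tsupp g `|` tsupp (f + g).
Lemma hullP f g : [/\ tsupp f `<=` hull f g, tsupp g `<=` hull f g
  & tsupp (f + g) `<=` hull f g].
Proof.
by split; apply/fsubsetP => s sX; rewrite !inE sX ?orbT.
Qed.

Fact tmulDl : left_distributive tmul +%R.
Proof.
move=> f g h; have [fX gX fgX] := hullP f g.
have hh := fsubset_refl (tsupp h).
rewrite (tmul_widen fgX hh) (tmul_widen fX hh) (tmul_widen gX hh).
rewrite -big_split; apply: eq_bigr => s _; rewrite -big_split.
by apply: eq_bigr => t _; rewrite /= tcoefD !mulrDl tsingleD.
Qed.

Fact tmulDr : right_distributive tmul +%R.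
Proof.
move=> h f g; have [fX gX fgX] := hullP f g.
have hh := fsubset_refl (tsupp h).
rewrite (tmul_widen hh fgX) (tmul_widen hh fX) (tmul_widen hh gX).
rewrite -big_split; apply: eq_bigr => s _; rewrite -big_split.
by apply: eq_bigr => t _; rewrite /= tcoefD raddfD/= mulrDr mulrDl tsingleD.
Qed.

Lemma tmul_single a s b t :
  tmul (tsingle a s) (tsingle b t) =
  tsingle (a * al s b * u s t) (s * t)%g.
Proof.
rewrite (tmul_widen (tsupp_single a s) (tsupp_single b t)).
by rewrite !big_seq_fset1 !tsingleE !eqxx.
Qed.

Lemma tmul0l f : tmul 0 f = 0.
Proof. by apply: (addrI (tmul 0 f)); rewrite -tmulDl !addr0. Qed.
Lemma tmul0r f : tmul f 0 = 0.
Proof. by apply: (addrI (tmul f 0)); rewrite -tmulDr !addr0. Qed.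

Lemma tmul_suml I (l : seq I) (F : I -> S) g :
  tmul (\sum_(i <- l) F i) g = \sum_(i <- l) tmul (F i) g.
Proof.
by apply: (big_morph (tmul^~ g)) => [f h|]; [exact: tmulDl|exact: tmul0l].
Qed.
Lemma tmul_sumr I (l : seq I) (F : I -> S) g :
  tmul g (\sum_(i <- l) F i) = \sum_(i <- l) tmul g (F i).
Proof.
by apply: (big_morph (tmul g)) => [f h|]; [exact: tmulDr|exact: tmul0r].
Qed.

Lemma tcp_ind (P : S -> Prop) : P 0 ->
  (forall f g, P f -> P g -> P (f + g)) -> (forall a s, P (tsingle a s)) ->
  forall f, P f.
Proof. by move=> P0 PD P1 f; rewrite [f]tcp_expand; apply: big_ind. Qed.

Fact tmulA : associative tmul.
Proof.
elim/tcp_ind => [g h|f1 f2 IH1 IH2 g h|a s].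
- by rewrite !tmul0l.
- by rewrite !tmulDl IH1 IH2.
elim/tcp_ind => [h|g1 g2 IH1 IH2 h|b t].
- by rewrite tmul0r !tmul0l tmul0r.
- by rewrite tmulDl tmulDr IH1 IH2 tmulDr tmulDl.
elim/tcp_ind => [|h1 h2 IH1 IH2|c r].
- by rewrite !tmul0r.
- by rewrite !tmulDr IH1 IH2.
rewrite !tmul_single mulgA; congr tsingle.
rewrite !rmorphM/= talM -!mulrA; do 2 congr (_ * _); congr (_ * _).
by rewrite tu_cocycle mulrA mulrA -[X in X * _]mulrA tu_unitaryl mulr1.
Qed.

Fact tmul1l : left_id tone tmul.
Proof.
elim/tcp_ind => [|f g IH1 IH2|a s]; first by rewrite tmul0r.
- by rewrite tmulDr IH1 IH2.
- by rewrite tmul_single tal1 tu1l mulr1 !mul1r mul1g.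
Qed.

Fact tmul1r : right_id tone tmul.
Proof.
elim/tcp_ind => [|f g IH1 IH2|a s]; first by rewrite tmul0l.
- by rewrite tmulDl IH1 IH2.
- by rewrite tmul_single rmorph1 tu1r !mulr1 mulg1.
Qed.

Fact tone_neq0 : tone != 0.
Proof.
apply/eqP => /(congr1 (tcoef^~ 1%g)).
by rewrite /= tcoef0 tsingleE eqxx => /eqP; rewrite oner_eq0.
Qed.

HB.instance Definition _ := GRing.Zmodule_isNzRing.Build S
  tmulA tmul1l tmul1r tmulDl tmulDr tone_neq0.

Fact tscaleA k l f : tscale k (tscale l f) = tscale (k * l) f.
Proof. by apply: tcpP => s; rewrite !tscaleE scalerA. Qed.
Fact tscale1 : left_id 1 tscale.
Proof. by move=> f; apply: tcpP => s; rewrite tscaleE scale1r. Qed.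
Fact tscaleDr : right_distributive tscale +%R.
Proof.
by move=> k f g; apply: tcpP => s; rewrite tcoefD !tscaleE tcoefD scalerDr.
Qed.
Fact tscaleDl f : {morph tscale^~ f : k l / k + l}.
Proof.
by move=> k l; apply: tcpP => s; rewrite tcoefD !tscaleE scalerDl.
Qed.

HB.instance Definition _ := GRing.Zmodule_isLmodule.Build C S
  tscaleA tscale1 tscaleDr tscaleDl.

Lemma tscale_single k a s : k *: tsingle a s = tsingle (k *: a) s.
Proof.
apply: tcpP => t; rewrite [LHS]tscaleE !tsingleE.
by case: ifP; rewrite ?scaler0.
Qed.

Lemma tmulE f g : f * g = tmul f g. Proof. by []. Qed.

Fact tscaleAl k f g : k *: (f * g) = (k *: f) * g.
Proof.
elim/tcp_ind: f => [|f1 f2 IH1 IH2|a s].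
- by rewrite scaler0 !mul0r scaler0.
- by rewrite scalerDr !mulrDl scalerDr IH1 IH2.
elim/tcp_ind: g => [|g1 g2 IH1 IH2|b t].
- by rewrite !mulr0 scaler0.
- by rewrite !mulrDr scalerDr IH1 IH2.
by rewrite tscale_single !tmulE !tmul_single tscale_single !scalerAl.
Qed.

HB.instance Definition _ := GRing.Lmodule_isLalgebra.Build C S tscaleAl.

Fact tscaleAr k f g : k *: (f * g) = f * (k *: g).
Proof.
elim/tcp_ind: f => [|f1 f2 IH1 IH2|a s].
- by rewrite !mul0r scaler0.
- by rewrite !mulrDl scalerDr IH1 IH2.
elim/tcp_ind: g => [|g1 g2 IH1 IH2|b t].
- by rewrite scaler0 !mulr0 scaler0.
- by rewrite scalerDr !mulrDr scalerDr IH1 IH2.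
rewrite tscale_single !tmulE !tmul_single tscale_single linearZ/=.
by rewrite -scalerAr -scalerAl.
Qed.

HB.instance Definition _ := GRing.Lalgebra_isAlgebra.Build C S tscaleAr.

Lemma tstar_widen f X : tsupp f `<=` X ->
  tstar f = \sum_(s <- X)
    tsingle (star (u s^-1%g s) * al s^-1%g (star (tcoef f s))) s^-1%g.
Proof.
move=> fX; apply: tsum_widen => // s /tsuppPn ->.
by rewrite star0 raddf0 mulr0 tsingle0.
Qed.

Fact tstarD : {morph tstar : f g / f + g}.
Proof.
move=> f g; have [fX gX fgX] := hullP f g.
rewrite (tstar_widen fgX) (tstar_widen fX) (tstar_widen gX).
rewrite -big_split; apply: eq_bigr => s _ /=.
by rewrite tcoefD starD raddfD/= mulrDr tsingleD.
Qed.

Lemma tstar0 : tstar 0 = 0.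
Proof. by apply: (addrI (tstar 0)); rewrite -tstarD !addr0. Qed.

Lemma tstar_single a s : tstar (tsingle a s) =
  tsingle (star (u s^-1%g s) * al s^-1%g (star a)) s^-1%g.
Proof.
rewrite (tstar_widen (tsupp_single a s)).
by rewrite big_seq_fset1 tsingleE eqxx.
Qed.

Fact tstarK : involutive tstar.
Proof.
elim/tcp_ind => [|f g IH1 IH2|a s]; first by rewrite !tstar0.
- by rewrite !tstarD IH1 IH2.
rewrite !tstar_single invgK; congr tsingle.
rewrite starM starK -tal_star starK rmorphM/= talM mulgV tal1.
have -> : al s (u s^-1%g s) = u s s^-1%g.
  by have := tu_cocycle act s s^-1%g s; rewrite mulVg mulgV tu1r tu1l !mulr1.
by rewrite -!mulrA tu_unitaryl mulr1 mulrA tu_unitaryl mul1r.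
Qed.

Fact tstarZ (k : C) f : tstar (k *: f) = (k^*)%R *: tstar f.
Proof.
elim/tcp_ind: f => [|f g IH1 IH2|a s]; first by rewrite scaler0 tstar0 scaler0.
- by rewrite scalerDr !tstarD IH1 IH2 scalerDr.
rewrite tscale_single !tstar_single tscale_single; congr tsingle.
by rewrite starZ linearZ/= scalerAr.
Qed.

Fact tstarM f g : tstar (f * g) = tstar g * tstar f.
Proof.
elim/tcp_ind: f => [|f1 f2 IH1 IH2|a s].
- by rewrite mul0r tstar0 mulr0.
- by rewrite mulrDl !tstarD IH1 IH2 mulrDr.
elim/tcp_ind: g => [|g1 g2 IH1 IH2|b t].
- by rewrite mulr0 tstar0 mul0r.
- by rewrite mulrDr !tstarD IH1 IH2 mulrDl.
rewrite !tmulE !(tmul_single, tstar_single).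
rewrite -invgM; congr tsingle.
set r := ((s * t)^-1)%g.
have rst : (t^-1 * s^-1)%g = r by rewrite /r invgM.
have rs : (r * s)%g = t^-1%g by rewrite -rst -mulgA mulVg mulg1.
have h1 := tu_cocycle act r s t; rewrite rs in h1.
have h2 := tu_cocycle act t^-1%g s^-1%g s.
rewrite mulVg tu1r mulr1 rst in h2.
have {}h1 : star (u r (s * t)%g) * al r (star (u s t))
          = star (u t^-1%g t) * star (u r s).
  by rewrite tal_star -!starM h1.
have {}h2 : al t^-1%g (star (u s^-1%g s)) * u t^-1%g s^-1%g = star (u r s).
  by rewrite tal_star h2 starM -mulrA tu_unitaryl mulr1.
rewrite !starM !rmorphM/= -!tal_star (talM act r s) rs.
rewrite (talM act t^-1%g s^-1%g) rst.
rewrite mulrA h1 -!mulrA tu_unitaryl mulr1 (mulrA (al _ (star (u _ s)))) h2.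
by rewrite (mulrA (star (u r s))) tu_unitaryl mul1r.
Qed.

HB.instance Definition _ := hasStar.Build C S tstarK tstarD tstarZ tstarM.

End TwistedCrossedProduct.

(* [iota] exhibits [B] as the completion of [tcp act] for [max_norm]. *)
Record max_crossed_product (R : realType) (Gam : groupType)
    (A : cstarAlgType R) (act : twistedAction Gam A) (B : cstarAlgType R)
    (iota : {lrmorphism tcp act -> B}) : Prop := {
  mcp_star : forall f, iota (star f) = star (iota f);
  mcp_norm : forall f, cnorm (iota f) = max_norm f;
  mcp_dense : forall b e, 0 < e -> exists f, cnorm (b - iota f) < e
}.

Record cond_expectation (R : realType) (Gam : groupType)
    (A : cstarAlgType R) (act : twistedAction Gam A) (B : cstarAlgType R)
    (iota : tcp act -> B) (E : B -> A) : Prop := {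
  ce_linear : linear E;
  ce1 : E 1 = 1;
  ce_pos : forall b, cpositive b -> cpositive (E b);
  ce_diag : forall a, E (iota (tsingle act a 1%g)) = a;
  ce_offdiag : forall a s, s != 1%g -> E (iota (tsingle act a s)) = 0
}.

(* Nonempty finite subsets F of the group; F stands for the nonzero member
   \sum_(s in F) A s^bar of the approximation system, free of rank |F|. *)
Definition approx_sys (Gam : groupType) := {F : {fset Gam} | F != fset0}.

Section InducedRank.
Variables (C : numClosedFieldType) (Gam : groupType) (A : starAlgType C).
Variable act : twistedAction Gam A.
Local Notation S := (tcp act).

Definition approx_mod (F : {fset Gam}) : set S :=
  [set f | exists a : Gam -> A, f = \sum_(s <- F) tsingle act (a s) s].

Definition approx_dim (F : {fset Gam}) : nat := #|` F|%fset.

Definition mod_mul (W V : set S) : set S :=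
  [set f | exists k (w v : 'I_k -> S),
    [/\ forall i, W (w i), forall i, V (v i) & f = \sum_i w i * v i]].

Definition invariant_mod (R : realType) (V : {fset S}) (e : R)
    (F : {fset Gam}) : Prop :=
  exists F' : {fset Gam},
    [set w + x | w in approx_mod F & x in mod_mul (approx_mod F) [set` V]]
      `<=` approx_mod F' /\
    (approx_dim F')%:R <= (1 + e) * (approx_dim F)%:R.

Definition row_mod n (W : set S) : set 'rV[S]_n :=
  [set x | forall j, W (x 0 j)].

(* [A] acts on row vectors over [tcp act] through a |-> a 1^bar. *)
Definition left_comb n l (c : 'rV[A]_l) (w : 'I_l -> 'rV[S]_n) : 'rV[S]_n :=
  \sum_i tsingle act (c 0 i) 1%g *: w i.

Definition row_basis n l (X : set 'rV[S]_n) (w : 'I_l -> 'rV[S]_n) : Prop :=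
  (forall i, X (w i)) /\
  (forall x, X x -> exists! c : 'rV[A]_l, x = left_comb c w).

Section RankFunction.
Variables (R : realType) (rk : forall n m, 'M[A]_(n, m) -> R).

Definition is_rank_at n m (M : 'M[S]_(n, m)) (F : {fset Gam}) (r : R) : Prop :=
  exists (F' : approx_sys Gam) l p (w : 'I_l -> 'rV[S]_n)
      (w' : 'I_p -> 'rV[S]_m) (B : 'M[A]_(l, p)),
    [/\ forall f i j, approx_mod F f -> approx_mod (val F') (f * M i j),
        row_basis (row_mod (approx_mod F)) w,
        row_basis (row_mod (approx_mod (val F'))) w',
        forall i, w i *m M = left_comb (row i B) w'
      & r = rk B].

(* rk_W(A) does not depend on the choices in [is_rank_at] when [rk] is a
   Sylvester rank function. *)
Definition rank_at n m (M : 'M[S]_(n, m)) (F : {fset Gam}) : R :=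
  xget 0 [set r | is_rank_at M F r].

Definition rank_approx (omega : set_system (approx_sys Gam)) n m
    (M : 'M[S]_(n, m)) : R :=
  lim ((fun F : approx_sys Gam =>
    rank_at M (val F) / (approx_dim (val F))%:R) @ omega).

End RankFunction.
End InducedRank.

(* Main.v *)
(* The rank of a matrix is the trace of the projection on the closure of its
   range, and 1 - (1 - c B B^* )^k converges strongly to that projection for
   small c > 0.  Hence, in the Hilbert-Schmidt norm of the trace,
     rk B = n - inf_Y |1 - B Y|^2,
   where the infimum can be taken over matrices with entries in the given
   *-algebra, and rk B = rk B^*.

   Let B_F be the matrix over A of the map induced by M on the span of F, with
   values in the span of F'.  Compressing M Y to the span of F sends a candidate
   Y for M to a candidate for B_F, without increasing the norm by Bessel's
   inequality, so that |F| rk M <= rk B_F.  Averaging over F' turns a candidate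
   for B_F^* into a candidate for M^*, so that rk B_F <= |F'| rk M.  As
   |F'| <= (1 + e) |F| for almost invariant F, both bounds together give the
   limit. *)

Require Import Defs.
From HB Require Import structures.
From mathcomp Require Import all_boot all_order all_algebra finmap.
From mathcomp Require Import complex.
From mathcomp Require Import all_classical all_reals topology normedtype.
From mathcomp Require Import ring lra.

Set Implicit Arguments.
Unset Strict Implicit.
Unset Printing Implicit Defensive.

Import Order.TTheory GRing.Theory Num.Theory.
Import numFieldNormedType.Exports.

Local Open Scope classical_set_scope.
Local Open Scope complex_scope.
Local Open Scope ring_scope.

(** * Hilbert space geometry of column vectors *)

Section ColumnHilbert.
Variables (R : realType) (H : hilbertType R).
Implicit Types (x y z : H).

Lemma innerZr c x y : inner x (c *: y) = (c^*)%R * inner x y.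
Proof. by rewrite innerC innerZl rmorphM/= -innerC. Qed.

Lemma innerNl x y : inner (- x) y = - inner x y.
Proof. by rewrite -scaleN1r innerZl mulN1r. Qed.

Lemma inner0l y : inner 0 y = 0.
Proof. by rewrite -(scale0r (0 : H)) innerZl mul0r. Qed.

Lemma inner_suml I (r : seq I) (P : pred I) (F : I -> H) y :
  inner (\sum_(i <- r | P i) F i) y = \sum_(i <- r | P i) inner (F i) y.
Proof.
by apply: (big_morph (inner^~ y)) => [a b|]; [exact: innerDl|exact: inner0l].
Qed.

Lemma inner_sumr I (r : seq I) (P : pred I) (F : I -> H) y :
  inner y (\sum_(i <- r | P i) F i) = \sum_(i <- r | P i) inner y (F i).
Proof.
rewrite innerC inner_suml rmorph_sum/=.
by apply: eq_bigr => i _; rewrite -innerC.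
Qed.

Variable n : nat.
Implicit Types u v w : 'cV[H]_n.

(** The real part turns the estimates below into arithmetic in [R]. Orthogonality for [cinner] is
    recovered by testing against a vector and its multiple by ['i]. *)
Definition rinner u v : R := complex.Re (cinner u v).
Definition sqnorm v : R := rinner v v.

Lemma cinnerC u v : cinner v u = ((cinner u v)^*)%R.
Proof.
by rewrite /cinner rmorph_sum; apply: eq_bigr => i _; rewrite innerC.
Qed.

Lemma cinnerDl u v w : cinner (u + v) w = cinner u w + cinner v w.
Proof.
by rewrite /cinner -big_split; apply: eq_bigr => i _; rewrite mxE innerDl.
Qed.

Lemma cinnerNl u v : cinner (- u) v = - cinner u v.
Proof.
by rewrite /cinner -sumrN; apply: eq_bigr => i _; rewrite mxE innerNl.
Qed.

Lemma cinnerZl c u v : cinner (map_mx ( *:%R c) u) v = c * cinner u v.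
Proof.
by rewrite /cinner mulr_sumr; apply: eq_bigr => i _; rewrite mxE innerZl.
Qed.

Lemma complexRe_conj (c : R[i]) : complex.Re ((c^*)%R) = complex.Re c.
Proof. by case: c. Qed.

Lemma rinnerC u v : rinner u v = rinner v u.
Proof. by rewrite /rinner cinnerC complexRe_conj. Qed.

Lemma rinnerDl u v w : rinner (u + v) w = rinner u w + rinner v w.
Proof. by rewrite /rinner cinnerDl raddfD. Qed.

Lemma rinnerNl u v : rinner (- u) v = - rinner u v.
Proof. by rewrite /rinner cinnerNl raddfN. Qed.

Lemma rinnerBl u v w : rinner (u - v) w = rinner u w - rinner v w.
Proof. by rewrite rinnerDl rinnerNl. Qed.

Lemma rinnerBr u v w : rinner w (u - v) = rinner w u - rinner w v.
Proof. by rewrite !(rinnerC w) rinnerBl. Qed.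

Lemma Re_realM (c : R) (z : R[i]) : complex.Re (c%:C * z) = c * complex.Re z.
Proof. by case: z => a b /=; rewrite mul0r subr0. Qed.

Lemma rinnerZl (c : R) u v : rinner (map_mx ( *:%R c%:C) u) v = c * rinner u v.
Proof. by rewrite /rinner cinnerZl Re_realM. Qed.

Lemma rinnerZr (c : R) u v : rinner u (map_mx ( *:%R c%:C) v) = c * rinner u v.
Proof. by rewrite rinnerC rinnerZl rinnerC. Qed.

Lemma Re_natr k : complex.Re (k%:R : R[i]) = k%:R.
Proof. by rewrite -(rmorph_nat (real_complex R)). Qed.

Lemma Re_inner_ge0 x : 0 <= complex.Re (inner x x).
Proof.
rewrite inner_norm; have := exprn_ge0 2 (normr_ge0 x).
by rewrite lecE => /andP[].
Qed.

Lemma sqnormE v : sqnorm v = \sum_i complex.Re (inner (v i 0) (v i 0)).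
Proof. by rewrite /sqnorm /rinner /cinner raddf_sum. Qed.

Lemma sqnorm_ge0 v : 0 <= sqnorm v.
Proof. by rewrite sqnormE sumr_ge0// => i _; exact: Re_inner_ge0. Qed.

Lemma sqnormB u v : sqnorm (u - v) = sqnorm u + sqnorm v - 2 * rinner u v.
Proof. by rewrite /sqnorm !(rinnerBl, rinnerBr) (rinnerC v u); ring. Qed.

Lemma sqnormD u v : sqnorm (u + v) = sqnorm u + sqnorm v + 2 * rinner u v.
Proof.
by rewrite /sqnorm !rinnerDl !(rinnerC _ (u + v)) !rinnerDl (rinnerC v u); ring.
Qed.

Lemma sqnormZ (c : R) v : sqnorm (map_mx ( *:%R c%:C) v) = c ^+ 2 * sqnorm v.
Proof. by rewrite /sqnorm rinnerZl rinnerZr mulrA. Qed.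

Lemma sqnorm_add_le u v : sqnorm (u + v) <= 2 * sqnorm u + 2 * sqnorm v.
Proof.
by have := sqnorm_ge0 (u - v); rewrite sqnormB sqnormD => ?; lra.
Qed.

Lemma cauchy_schwarz u v : rinner u v ^+ 2 <= sqnorm u * sqnorm v.
Proof.
have h t : 0 <= sqnorm u + t ^+ 2 * sqnorm v - 2 * t * rinner u v.
  have := sqnorm_ge0 (u - map_mx ( *:%R t%:C) v).
  by rewrite sqnormB sqnormZ rinnerZr mulrA.
have := sqnorm_ge0 v; rewrite le_eqVlt => /orP[/eqP v0|v0]; last first.
  (* This t minimizes the quadratic in [h]. *)
  have := h (rinner u v / sqnorm v).
  have -> : sqnorm u + (rinner u v / sqnorm v) ^+ 2 * sqnorm v -
    2 * (rinner u v / sqnorm v) * rinner u v =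
    (sqnorm u * sqnorm v - rinner u v ^+ 2) / sqnorm v.
    by field; rewrite gt_eqF.
  by rewrite pmulr_lge0 ?invr_gt0// subr_ge0.
rewrite -v0 mulr0.
have [->|r0] := eqVneq (rinner u v) 0; first by rewrite expr0n.
(* With |v| = 0 the expression in [h] is affine in t, and this t gives it the value -1. *)
have := h ((sqnorm u + 1) / (2 * rinner u v)); rewrite -v0 mulr0 addr0.
have -> : 2 * ((sqnorm u + 1) / (2 * rinner u v)) * rinner u v = sqnorm u + 1.
  by field.
by lra.
Qed.

Lemma Re_inner_norm x : complex.Re (inner x x) = complex.Re `|x| ^+ 2.
Proof.
rewrite inner_norm; have : `|x| \is Num.real by exact: normr_real.
by move=> /complex_realP[k ->]; rewrite -rmorphXn.
Qed.

Lemma norm_ltP x (e : R) : 0 < e ->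
  `|x| < e%:C = (complex.Re (inner x x) < e ^+ 2).
Proof.
move=> e0; rewrite Re_inner_norm.
have /complex_realP[k xk] : `|x| \is Num.real by exact: normr_real.
have k0 : 0 <= k by rewrite -ler0c -xk.
by rewrite xk ltcR /= ltr_pXn2r// nnegrE ltW.
Qed.

Lemma sqnorm_ball u v (e : R) : 0 < e -> sqnorm (u - v) < e ^+ 2 ->
  ball u e%:C v.
Proof.
move=> e0; rewrite sqnormE => h; split; first by rewrite ltcR.
move=> i j; rewrite ord1 -ball_normE/= norm_ltP//.
apply: le_lt_trans h; rewrite (bigD1 i)//= !mxE lerDl sumr_ge0// => k _.
exact: Re_inner_ge0.
Qed.

(** Balls of ['cV[H]_n] bound each entry separately, whence the factor n. *)
Lemma ball_sqnorm u v (e : R) : 0 < e -> ball u e%:C v ->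
  sqnorm (u - v) <= n%:R * e ^+ 2.
Proof.
move=> e0 [_ h]; rewrite sqnormE.
apply: le_trans (_ : \sum_(i < n) e ^+ 2 <= _); last first.
  by rewrite sumr_const card_ord mulr_natl.
apply: ler_sum => i _; have := h i 0; rewrite -ball_normE/= norm_ltP//.
by rewrite !mxE => /ltW.
Qed.

Lemma closure_sqnormP (X : set 'cV[H]_n) v :
  closure X v <-> forall e, 0 < e -> exists2 x, X x & sqnorm (v - x) < e.
Proof.
split=> [cv e e0|h].
  (* n d^2 = n e / (n + 1) < e, also for n = 0. *)
  pose d := Num.sqrt (e / (n%:R + 1)).
  have n1 : 0 < n%:R + 1 :> R by rewrite ltr_wpDl.
  have d0 : 0 < d by rewrite sqrtr_gt0 divr_gt0.
  have [|x [Xx]] := cv (ball v d%:C).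
    by apply: nbhsx_ballx; rewrite ltcR.
  move=> /(ball_sqnorm d0) h; exists x => //; apply: le_lt_trans h _.
  rewrite sqr_sqrtr ?divr_ge0 ?ltW// mulrA ltr_pdivrMr// mulrC.
  by rewrite ltr_pM2l// ltrDl.
move=> U /nbhs_ballP[e /= e0 eU].
have /complex_realP[k ek] : e \is Num.real by exact: gtr0_real.
rewrite ek in e0 eU; have k0 : 0 < k by rewrite -ltcR.
have [|x Xx vx] := h (k ^+ 2); first by rewrite exprn_gt0.
by exists x; split => //; apply: eU; exact: sqnorm_ball.
Qed.

Lemma sqnorm_complete (x : nat -> 'cV[H]_n) :
  (forall e, 0 < e -> exists N, forall k l, (N <= k)%N -> (N <= l)%N ->
     sqnorm (x k - x l) < e) ->
  exists v, forall e, 0 < e -> exists N, forall k, (N <= k)%N ->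
     sqnorm (x k - v) < e.
Proof.
move=> xC; have : cvg (x @ \oo).
  apply: cauchy_cvg; apply/cauchy_exP => e e0.
  have /complex_realP[d ed] : e \is Num.real by exact: gtr0_real.
  rewrite ed in e0 *; have d0 : 0 < d by rewrite -ltcR.
  have [|N xN] := xC (d ^+ 2); first by rewrite exprn_gt0.
  exists (x N), N => // k /= Nk; apply: sqnorm_ball => //; exact: xN.
move=> /cvg_ex[v xv]; exists v => e e0.
pose d := Num.sqrt (e / (n%:R + 1)).
have n1 : 0 < n%:R + 1 :> R by rewrite ltr_wpDl.
have d0 : 0 < d by rewrite sqrtr_gt0 divr_gt0.
have : \forall k \near \oo, ball v d%:C (x k).
  by apply: xv; apply: nbhsx_ballx; rewrite ltcR.
move=> [N _ h]; exists N => k Nk; have /(ball_sqnorm d0) := h _ Nk.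
rewrite -opprB /sqnorm rinnerNl rinnerC rinnerNl opprK.
move=> vx; apply: le_lt_trans vx _.
rewrite sqr_sqrtr ?divr_ge0 ?ltW// mulrA ltr_pdivrMr// mulrC.
by rewrite ltr_pM2l// ltrDl.
Qed.

End ColumnHilbert.

(** * Adjoints and complex scaling of matrices over a star algebra *)

Section StarMatrix.
Variables (C : numClosedFieldType) (S : starAlgType C).

Lemma starN (x : S) : star (- x) = - star x.
Proof. by apply: (addrI (star x)); rewrite -starD !subrr star0. Qed.

Lemma starB (x y : S) : star (x - y) = star x - star y.
Proof. by rewrite starD starN. Qed.

Lemma star_sum I (r : seq I) (P : pred I) (F : I -> S) :
  star (\sum_(i <- r | P i) F i) = \sum_(i <- r | P i) star (F i).
Proof. by apply: (big_morph star) => [a b|]; [exact: starD|exact: star0]. Qed.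

Definition adjmx n m (X : 'M[S]_(n, m)) : 'M[S]_(m, n) :=
  \matrix_(i, j) star (X j i).

Lemma adjmxK n m : cancel (@adjmx n m) (@adjmx m n).
Proof. by move=> X; apply/matrixP => i j; rewrite !mxE starK. Qed.

Lemma adjmxM n m p (X : 'M[S]_(n, m)) (Y : 'M[S]_(m, p)) :
  adjmx (X *m Y) = adjmx Y *m adjmx X.
Proof.
apply/matrixP => i j; rewrite !mxE star_sum.
by apply: eq_bigr => k _; rewrite !mxE starM.
Qed.

Lemma adjmxB n m (X Y : 'M[S]_(n, m)) : adjmx (X - Y) = adjmx X - adjmx Y.
Proof. by apply/matrixP => i j; rewrite !mxE starB. Qed.

Lemma adjmx_scalar n (a : S) : adjmx (a%:M : 'M[S]_n) = (star a)%:M.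
Proof.
by apply/matrixP => i j; rewrite !mxE eq_sym; case: eqP; rewrite ?star0.
Qed.

Lemma adjmx1 n : adjmx (1%:M : 'M[S]_n) = 1%:M.
Proof. by rewrite adjmx_scalar star1. Qed.

Lemma adjmxX n (X : 'M[S]_n) k : adjmx (X ^+ k) = adjmx X ^+ k.
Proof.
elim: k => [|k IH]; first by rewrite !expr0 adjmx1.
by rewrite exprS exprSr -[X * _]/(X *m _) adjmxM IH.
Qed.

Lemma adjmxMn n m (X : 'M[S]_(n, m)) k : adjmx (X *+ k) = adjmx X *+ k.
Proof.
apply/matrixP => i j; rewrite mxE !mulmxnE mxE.
by elim: k => [|k IH]; rewrite ?mulr0n ?star0// !mulrS starD IH.
Qed.

(* The entries of a matrix over [S] can only be multiplied by scalars of [C]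
   entrywise: the scaling of ['M[S]_(n, m)] is by elements of [S]. *)
Definition cscalemx n m (c : C) (X : 'M[S]_(n, m)) : 'M[S]_(n, m) :=
  map_mx ( *:%R c) X.

Lemma cscalemx_mull n m p c (X : 'M[S]_(n, m)) (Y : 'M[S]_(m, p)) :
  cscalemx c X *m Y = cscalemx c (X *m Y).
Proof.
apply/matrixP => i j; rewrite !mxE scaler_sumr.
by apply: eq_bigr => k _; rewrite !mxE scalerAl.
Qed.

Lemma cscalemx_mulr n m p c (X : 'M[S]_(n, m)) (Y : 'M[S]_(m, p)) :
  X *m cscalemx c Y = cscalemx c (X *m Y).
Proof.
apply/matrixP => i j; rewrite !mxE scaler_sumr.
by apply: eq_bigr => k _; rewrite !mxE scalerAr.
Qed.

Lemma cscalemxB n m c (X Y : 'M[S]_(n, m)) :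
  cscalemx c (X - Y) = cscalemx c X - cscalemx c Y.
Proof. by apply/matrixP => i j; rewrite !mxE scalerBr. Qed.

Lemma adjmx_cscalemx n m c (X : 'M[S]_(n, m)) :
  adjmx (cscalemx c X) = cscalemx (c^*)%R (adjmx X).
Proof. by apply/matrixP => i j; rewrite !mxE starZ. Qed.

(** The common Q is the sum of Y (1 - X Y)^j over j < k; it serves both powers because (1 - X Y)^j X
    = X (1 - Y X)^j. *)
Lemma exp_1sub_mulmx n m (X : 'M[S]_(n, m)) (Y : 'M[S]_(m, n)) k :
  exists2 Q, (1%:M - X *m Y) ^+ k = 1%:M - X *m Q
           & (1%:M - Y *m X) ^+ k = 1%:M - Q *m X.
Proof.
elim: k => [|k [Q hX hY]].
  by exists 0; rewrite expr0 ?mulmx0 ?mul0mx subr0.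
exists (Y + Q - Q *m (X *m Y)).
- rewrite exprSr hX -[_ * _]/(_ *m _) mulmxBr mulmx1 mulmxBl mul1mx.
  rewrite !(mulmxBr, mulmxDr) !mulmxA.
  by rewrite !(opprD, opprK) !addrA; congr (_ + _); exact: addrAC.
- rewrite exprSr hY -[_ * _]/(_ *m _) mulmxBr mulmx1 mulmxBl mul1mx.
  rewrite !(mulmxBl, mulmxDl) -!mulmxA.
  by rewrite !(opprD, opprK) !addrA; congr (_ + _); exact: addrAC.
Qed.

End StarMatrix.

(** * Matrices over a star algebra acting on columns *)

Section MatrixRep.
Variables (R : realType) (S : starAlgType R[i]) (H : hilbertType R).
Variable pi : starRep S H.

HB.instance Definition _ f := GRing.isLinear.Build R[i] H H *:%R (pi f)
  (rep_linear pi f).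

Lemma rep0 x : pi 0 x = 0.
Proof. by rewrite -(scale0r (0 : S)) repZ scale0r. Qed.

Lemma repN f x : pi (- f) x = - pi f x.
Proof. by rewrite -scaleN1r repZ scaleN1r. Qed.

Lemma rep_sum I (r : seq I) (P : pred I) (F : I -> S) x :
  pi (\sum_(i <- r | P i) F i) x = \sum_(i <- r | P i) pi (F i) x.
Proof. by apply: (big_morph (pi^~ x)) => [f g|]; [exact: repD|exact: rep0]. Qed.

Lemma rep_mxM n m p (X : 'M[S]_(n, m)) (Y : 'M[S]_(m, p)) v :
  rep_mx pi (X *m Y) v = rep_mx pi X (rep_mx pi Y v).
Proof.
apply/matrixP => i k; rewrite !mxE.
under [RHS]eq_bigr do rewrite mxE linear_sum.
rewrite exchange_big/=; apply: eq_bigr => j _; rewrite mxE rep_sum.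
by apply: eq_bigr => l _; rewrite repM.
Qed.

Lemma rep_mxB n m (X Y : 'M[S]_(n, m)) v :
  rep_mx pi (X - Y) v = rep_mx pi X v - rep_mx pi Y v.
Proof.
apply/matrixP => i k; rewrite !mxE -sumrB.
by apply: eq_bigr => l _; rewrite !mxE repD repN.
Qed.

Lemma rep_mx_scaler n m (X : 'M[S]_(n, m)) c v :
  rep_mx pi X (map_mx ( *:%R c) v) = map_mx ( *:%R c) (rep_mx pi X v).
Proof.
apply/matrixP => i k; rewrite !mxE scaler_sumr.
by apply: eq_bigr => l _; rewrite !mxE linearZ.
Qed.

Lemma rep_mx1 n v : rep_mx pi (1%:M : 'M_n) v = v.
Proof.
apply/matrixP => i k; rewrite ord1 !mxE (bigD1 i)//= mxE eqxx rep1.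
rewrite big1 ?addr0// => j /negPf ji; rewrite mxE eq_sym ji.
exact: rep0.
Qed.

Lemma rep_mx_cscalemx n m c (X : 'M[S]_(n, m)) v :
  rep_mx pi (cscalemx c X) v = map_mx ( *:%R c) (rep_mx pi X v).
Proof.
apply/matrixP => i k; rewrite !mxE scaler_sumr.
by apply: eq_bigr => l _; rewrite !mxE repZ.
Qed.

Lemma rep_mx_adj n m (X : 'M[S]_(n, m)) u v :
  cinner (rep_mx pi X u) v = cinner u (rep_mx pi (adjmx X) v).
Proof.
rewrite /cinner; under eq_bigr do rewrite mxE inner_suml.
rewrite exchange_big/=; apply: eq_bigr => j _; rewrite mxE inner_sumr.
by apply: eq_bigr => i _; rewrite mxE rep_star.
Qed.

Lemma rinner_rep_mx n m (X : 'M[S]_(n, m)) u v :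
  rinner (rep_mx pi X u) v = rinner u (rep_mx pi (adjmx X) v).
Proof. by rewrite /rinner rep_mx_adj. Qed.

Lemma rinner_rep_mxr n m (X : 'M[S]_(n, m)) u v :
  rinner u (rep_mx pi X v) = rinner (rep_mx pi (adjmx X) u) v.
Proof. by rewrite rinner_rep_mx adjmxK. Qed.

Lemma rep_bounded f : exists2 K : R, 0 < K &
  forall x, complex.Re (inner (pi f x) (pi f x)) <= K * complex.Re (inner x x).
Proof.
have : bounded_near (pi f) (nbhs 0).
  apply: continuous_linear_bounded; exact: rep_continuous.
move=> /linear_boundedP/pinfty_ex_gt0[r r0 fr].
have /complex_realP[k rk] : r \is Num.real by exact: gtr0_real.
rewrite rk in r0 fr; have k0 : 0 < k by rewrite -ltcR.
exists (k ^+ 2) => [|x]; first by rewrite exprn_gt0.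
rewrite !Re_inner_norm -exprMn.
have /complex_realP[a ea] : `|pi f x| \is Num.real by exact: normr_real.
have /complex_realP[b eb] : `|x| \is Num.real by exact: normr_real.
have := normr_ge0 (pi f x); have := normr_ge0 x; have := fr x.
rewrite ea eb -rmorphM !lecR /= => ab b0 a0.
by rewrite lerXn2r// nnegrE mulr_ge0// ltW.
Qed.

(** One induction runs over the columns of X, where [sqnorm_add_le] costs a factor 2 at each step,
    and one over the entries of a column. Only the existence of a constant matters. *)
Lemma rep_mx_bounded n m (X : 'M[S]_(n, m)) : exists2 K : R, 0 < K &
  forall v, sqnorm (rep_mx pi X v) <= K * sqnorm v.
Proof.
suff hcol j : exists2 K : R, 0 < K & forall x : H,
    sqnorm (\col_i pi (X i j) x) <= K * complex.Re (inner x x).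
  suff [K K0 hK] : exists2 K : R, 0 < K & forall v : 'cV[H]_m,
      sqnorm (\sum_j \col_i pi (X i j) (v j 0))
        <= K * \sum_j complex.Re (inner (v j 0) (v j 0)).
    exists K => // v; rewrite [X in _ <= _ * X]sqnormE.
    have -> // : rep_mx pi X v = \sum_j \col_i pi (X i j) (v j 0).
    apply/matrixP => i k; rewrite summxE mxE.
    by apply: eq_bigr => j _; rewrite mxE.
  elim: (index_enum _) => [|j r [K K0 IH]].
    exists 1 => // v; rewrite !big_nil /sqnorm /rinner /cinner big1 ?mulr0//.
    by move=> i _; rewrite mxE inner0l.
  have [L L0 hL] := hcol j.
  exists (2 * (K + L)) => [|v]; first by rewrite mulr_gt0 ?addr_gt0.
  rewrite !big_cons; apply: le_trans (sqnorm_add_le _ _) _.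
  have := IH v; have := hL (v j 0); set a := sqnorm _; set b := sqnorm _.
  set c := complex.Re _; set d := \sum_(_ <- r) _ => ha hb.
  have c0 : 0 <= c by exact: Re_inner_ge0.
  have d0 : 0 <= d by apply: sumr_ge0 => i _; exact: Re_inner_ge0.
  have := mulr_ge0 (ltW K0) c0; have := mulr_ge0 (ltW L0) d0; nra.
suff [K K0 hK] : exists2 K : R, 0 < K & forall x : H,
    \sum_i complex.Re (inner (pi (X i j) x) (pi (X i j) x))
      <= K * complex.Re (inner x x).
  by exists K => // x; rewrite sqnormE; under eq_bigr do rewrite !mxE.
elim: (index_enum _) => [|i r [K K0 IH]].
  by exists 1 => // x; rewrite big_nil mul1r Re_inner_ge0.
have [L L0 hL] := rep_bounded (X i j).
exists (L + K) => [|x]; first exact: addr_gt0.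
by rewrite big_cons mulrDl lerD.
Qed.

End MatrixRep.

(** * Orthogonal projection on a closed range *)

Lemma nonincreasing_limit (R : realType) (b : nat -> R) :
  (forall k, 0 <= b k) -> (forall k, b k.+1 <= b k) ->
  exists L, forall e, 0 < e ->
    exists N, forall k, (N <= k)%N -> L <= b k < L + e.
Proof.
move=> b0 bd; have hb : has_inf (range b).
  by split; [exists (b 0), 0 | exists 0 => _ [k _ <-]].
exists (inf (range b)) => e e0.
have [_ [N _ <-] bN] := inf_adherent e0 hb.
exists N => k Nk; rewrite inf_lbound//=; [|exact: hb.2|by exists k].
apply: le_lt_trans bN; elim: k Nk => [|k IH]; first by rewrite leqn0 => /eqP ->.
by rewrite leq_eqVlt => /orP[/eqP -> //|/IH]; exact: le_trans.
Qed.

(** [orthproj] is defined by choice, so uniqueness identifies it: for two candidates p and q the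
    residuals v - p and v - q are orthogonal to both p and q, and q - p is a difference of
    residuals. *)
Lemma orthprojP (R : realType) (H : hilbertType R) n (X : set 'cV[H]_n) v p :
  X p -> (forall w, X w -> cinner (v - p) w = 0) -> orthproj X v = p.
Proof.
move=> Xp pX; rewrite /orthproj.
case: xgetP => [q _ [Xq qX]|/(_ p)]; last by case; split.
have : sqnorm (q - p) = 0.
  rewrite /sqnorm rinnerBr.
  have -> : q - p = (v - p) - (v - q) by rewrite opprB [RHS]addrC addrA subrK.
  rewrite /rinner !(cinnerDl (v - p)) !cinnerNl.
  by rewrite (pX _ Xq) (pX _ Xp) (qX _ Xq) (qX _ Xp) subrr.
rewrite sqnormE => /eqP; rewrite psumr_eq0 => [/allP qp|i _]; last first.
  exact: Re_inner_ge0.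
apply/matrixP => i j; rewrite ord1.
have := qp i; rewrite mem_index_enum => /(_ isT).
rewrite Re_inner_norm sqrf_eq0 => /eqP h.
have /complex_realP[k hk] : `|(q - p) i 0| \is Num.real by exact: normr_real.
move: h; rewrite hk /= => k0; apply/eqP; rewrite -subr_eq0 -normr_eq0.
by move: hk; rewrite !mxE k0 => ->.
Qed.

(** The product is conjugate linear on the right, and Re (-i z) = Im z. *)
Lemma rinner_imZr (R : realType) (H : hilbertType R) n (u v : 'cV[H]_n) :
  rinner u (map_mx ( *:%R 'i%C) v) = complex.Im (cinner u v).
Proof.
rewrite /rinner cinnerC cinnerZl (cinnerC u v) complexRe_conj.
by case: (cinner u v) => a b /=; rewrite mul0r mul1r sub0r opprK.
Qed.

Section RangeProjection.
Variables (R : realType) (S : starAlgType R[i]) (H : hilbertType R).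
Variable pi : starRep S H.

Definition ranmx n m (B : 'M[S]_(n, m)) : set 'cV[H]_n :=
  closure (range (rep_mx pi B)).

Definition damp n m (c : R) (B : 'M[S]_(n, m)) : 'M[S]_n :=
  1%:M - B *m cscalemx c%:C (adjmx B).

Lemma adjmx_damp n m c (B : 'M[S]_(n, m)) : adjmx (damp c B) = damp c B.
Proof.
rewrite /damp adjmxB adjmx1 adjmxM adjmx_cscalemx adjmxK.
rewrite cscalemx_mull cscalemx_mulr.
by rewrite -[(_^*)%R]/(conjc _) conjc_real.
Qed.

(** Expanding gives |v|^2 - 2c |B^* v|^2 + c^2 |B B^* v|^2, whose last term is at most c |B^* v|^2
    because c K <= 1. *)
Lemma damp_le n m (B : 'M[S]_(n, m)) c K v : 0 < c -> c * K <= 1 ->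
  (forall w, sqnorm (rep_mx pi B w) <= K * sqnorm w) ->
  sqnorm (rep_mx pi (damp c B) v)
    <= sqnorm v - c * sqnorm (rep_mx pi (adjmx B) v).
Proof.
move=> c0 cK hK; rewrite rep_mxB rep_mx1 cscalemx_mulr rep_mx_cscalemx.
rewrite rep_mxM sqnormB.
rewrite sqnormZ rinnerZr rinner_rep_mxr -/(sqnorm _).
have := hK (rep_mx pi (adjmx B) v); have := sqnorm_ge0 (rep_mx pi (adjmx B) v).
set a := sqnorm (rep_mx pi B _); set b := sqnorm (rep_mx pi (adjmx B) v).
move=> b0 ab; have : c * a <= b.
  apply: le_trans (_ : c * K * b <= _); last by rewrite ler_piMl.
  by rewrite -mulrA ler_pM2l.
by move=> cab; nra.
Qed.

Lemma damp_range n m c (B : 'M[S]_(n, m)) k :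
  exists Q, damp c B ^+ k = 1%:M - B *m Q.
Proof.
by have [Q ->] := exp_1sub_mulmx B (cscalemx c%:C (adjmx B)) k; exists Q.
Qed.

(** Both powers involve the same Q of [exp_1sub_mulmx], so each side equals B - B Q B. *)
Lemma damp_intertwine n m c (B : 'M[S]_(n, m)) k :
  damp c B ^+ k *m B = B *m damp c (adjmx B) ^+ k.
Proof.
have [Q hQ hQ'] := exp_1sub_mulmx B (cscalemx c%:C (adjmx B)) k.
rewrite /damp adjmxK hQ cscalemx_mulr -cscalemx_mull hQ'.
by rewrite mulmxBl mulmxBr mul1mx mulmx1 mulmxA.
Qed.

(* The iterates x_k of the contraction satisfy <x_2k, x_2l> = |x_(k+l)|^2, a
   nonincreasing sequence in k + l, so the even ones are Cauchy.  Their limit is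
   orthogonal to the range because B y_k tends to 0 for the iterates y_k of
   1 - c B^* B, as c |B y_k|^2 <= |y_k|^2 - |y_(k+1)|^2. *)
Lemma damp_cvg n m (B : 'M[S]_(n, m)) : exists2 c : R, 0 < c & forall v,
  let p := orthproj (ranmx B) v in
  [/\ ranmx B p, forall w, ranmx B w -> cinner (v - p) w = 0
    & forall e, 0 < e -> exists N, forall k, (N <= k)%N ->
        sqnorm (rep_mx pi (damp c B ^+ k.*2) v - (v - p)) < e].
Proof.
have [K1 K10 hK1] := rep_mx_bounded pi B.
have [K2 K20 hK2] := rep_mx_bounded pi (adjmx B).
have K0 : 0 < K1 + K2 by exact: addr_gt0.
(* One c small enough for [damp_le] with B and with [adjmx B]. *)
pose c := (K1 + K2)^-1; have c0 : 0 < c by rewrite invr_gt0.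
have cK1 : c * K1 <= 1 by rewrite mulrC ler_pdivrMr// mul1r lerDl ltW.
have cK2 : c * K2 <= 1 by rewrite mulrC ler_pdivrMr// mul1r lerDr ltW.
exists c => // v.
pose x k := rep_mx pi (damp c B ^+ k) v.
have dampS (y : 'cV[H]_n) k : rep_mx pi (damp c B ^+ k.+1) y =
    rep_mx pi (damp c B) (rep_mx pi (damp c B ^+ k) y).
  by rewrite exprS -[_ * _]/(_ *m _) rep_mxM.
have dampS' (y : 'cV[H]_m) k : rep_mx pi (damp c (adjmx B) ^+ k.+1) y =
    rep_mx pi (damp c (adjmx B)) (rep_mx pi (damp c (adjmx B) ^+ k) y).
  by rewrite exprS -[_ * _]/(_ *m _) rep_mxM.
have xx k l : rinner (x k.*2) (x l.*2) = sqnorm (x (k + l)%N).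
  rewrite /sqnorm /x rinner_rep_mxr -rep_mxM rinner_rep_mxr -rep_mxM.
  rewrite !adjmxX !adjmx_damp -[_ *m _]/(_ * _).
  rewrite -[X in _ = rinner (rep_mx _ X _) _]/(_ * _).
  by rewrite -!exprD -doubleD addnn addnC.
have [L hL] : exists L, forall e, 0 < e ->
    exists N, forall k, (N <= k)%N -> L <= sqnorm (x k) < L + e.
  apply: nonincreasing_limit => k; first exact: sqnorm_ge0.
  rewrite /x dampS; apply: le_trans (damp_le _ c0 cK1 hK1) _.
  by rewrite gerBl mulr_ge0 ?sqnorm_ge0// ltW.
have [z hz] : exists z, forall e, 0 < e ->
    exists N, forall k, (N <= k)%N -> sqnorm (x k.*2 - z) < e.
  apply: sqnorm_complete => e e0.
  have [|N hN] := hL (e / 2); first by rewrite divr_gt0.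
  exists N => k l Nk Nl; rewrite sqnormB xx /sqnorm !xx.
  have /andP[_ h1] := hN (k + k)%N (leq_trans Nk (leq_addr _ _)).
  have /andP[_ h2] := hN (l + l)%N (leq_trans Nl (leq_addr _ _)).
  have /andP[h3 _] := hN (k + l)%N (leq_trans Nk (leq_addr _ _)).
  by rewrite -!/(sqnorm _); lra.
have zperp y : rinner z (rep_mx pi B y) = 0.
  have [M hM] : exists M, forall e, 0 < e -> exists N, forall k, (N <= k)%N ->
      M <= sqnorm (rep_mx pi (damp c (adjmx B) ^+ k) y) < M + e.
    apply: nonincreasing_limit => k; first exact: sqnorm_ge0.
    rewrite dampS'; apply: le_trans (damp_le _ c0 cK2 hK2) _.
    by rewrite gerBl mulr_ge0 ?sqnorm_ge0// ltW.
  have By e : 0 < e -> exists N, forall k, (N <= k)%N ->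
      sqnorm (rep_mx pi B (rep_mx pi (damp c (adjmx B) ^+ k) y)) < e.
    move=> e0; have [|N hN] := hM (c * e); first exact: mulr_gt0.
    exists N => k Nk.
    have := damp_le (rep_mx pi (damp c (adjmx B) ^+ k) y) c0 cK2 hK2.
    rewrite -dampS' adjmxK -(ltr_pM2l c0).
    have /andP[_ h1] := hN _ Nk; have /andP[h2 _] := hN _ (leqW Nk).
    lra.
  apply/eqP/negP => /negP nz.
  pose d := rinner z (rep_mx pi B y) ^+ 2.
  have d0 : 0 < d by rewrite exprn_even_gt0.
  set W := sqnorm (rep_mx pi B y); have W0 : 0 <= W by exact: sqnorm_ge0.
  set V := sqnorm v; have V0 : 0 <= V by exact: sqnorm_ge0.
  have W4 : 0 < 4 * (W + 1) by lra.
  have V4 : 0 < 4 * (V + 1) by lra.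
  (* The tolerances make the squares of <x_2k - z, B y> and <x_2k, B y> both smaller than d / 4 by
     Cauchy-Schwarz, against d <= 2 q^2 + 2 r^2. *)
  have [|N1 h1] := hz (d / (4 * (W + 1))); first by rewrite divr_gt0.
  have [|N2 h2] := By (d / (4 * (V + 1))); first by rewrite divr_gt0.
  have {}h1 := h1 (N1 + N2)%N (leq_addr _ _).
  have {}h2 := h2 (N1 + N2).*2 _.
  have {}h2 := h2 (leq_trans (leq_addl N1 _) (leq_trans (leq_addr _ _)
    (eq_leq (addnn _)))).
  set k := (N1 + N2)%N in h1 h2.
  have e1 : rinner z (rep_mx pi B y) =
      rinner (x k.*2) (rep_mx pi B y) - rinner (x k.*2 - z) (rep_mx pi B y).
    by rewrite -rinnerBl opprB addrA addrAC subrr add0r.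
  (* Self-adjointness moves the power of [damp] onto B y, and intertwining moves it past B. *)
  have e2 : rinner (x k.*2) (rep_mx pi B y) =
      rinner v (rep_mx pi B (rep_mx pi (damp c (adjmx B) ^+ k.*2) y)).
    rewrite -rep_mxM -damp_intertwine rep_mxM rinner_rep_mx adjmxX.
    by rewrite adjmx_damp.
  have c1 := cauchy_schwarz (x k.*2 - z) (rep_mx pi B y).
  have c2 := cauchy_schwarz v
     (rep_mx pi B (rep_mx pi (damp c (adjmx B) ^+ k.*2) y)).
  rewrite -e2 in c2; move: (e1) c1 c2 h1 h2.
  set q := rinner (x k.*2) _; set r := rinner (_ - z) _.
  set s := sqnorm (_ - z); set t := sqnorm (rep_mx pi B (rep_mx _ _ _)).
  rewrite -/W -/V => e3 c1 c2.
  have s0 : 0 <= s by exact: sqnorm_ge0.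
  have t0 : 0 <= t by exact: sqnorm_ge0.
  rewrite !ltr_pdivlMr// => h1 h2.
  have : d <= 2 * q ^+ 2 + 2 * r ^+ 2.
    by rewrite /d e3; have := sqr_ge0 (q + r); rewrite !expr2; nra.
  nra.
have czperp y : cinner z (rep_mx pi B y) = 0.
  apply/eqP; rewrite eq_complex; apply/andP; split; apply/eqP.
    exact: zperp.
  have := zperp (map_mx ( *:%R 'i%C) y).
  by rewrite rep_mx_scaler rinner_imZr.
(* Since x_2k = v - B Q v, the vector v - z is a limit of range elements B Q v. *)
have rvz : ranmx B (v - z).
  apply/closure_sqnormP => e e0; have [N hN] := hz e e0.
  have [Q hQ] := damp_range c B N.*2.
  exists (rep_mx pi B (rep_mx pi Q v)); first by exists (rep_mx pi Q v).
  have := hN N (leqnn _); rewrite /x hQ rep_mxB rep_mx1 -rep_mxM.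
  by rewrite [v - z - _]addrAC.
have zran w : ranmx B w -> cinner z w = 0.
  move=> /closure_sqnormP cw.
  have rz (u : 'cV[H]_n) : (forall e, 0 < e ->
      exists2 x, range (rep_mx pi B) x & sqnorm (u - x) < e) -> rinner z u = 0.
    move=> cu; apply/eqP/negP => /negP nz.
    have d0 : 0 < rinner z u ^+ 2 by rewrite exprn_even_gt0.
    have z0 : 0 < sqnorm z + 1 by rewrite ltr_wpDl// sqnorm_ge0.
    (* Within this distance, <z, u> = <z, u - B y> violates Cauchy-Schwarz. *)
    have [|_ [y _ <-]] := cu (rinner z u ^+ 2 / (sqnorm z + 1)).
      by rewrite divr_gt0.
    rewrite ltr_pdivlMr// => h.
    have := cauchy_schwarz z (u - rep_mx pi B y).
    rewrite rinnerBr zperp subr0.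
    have := sqnorm_ge0 (u - rep_mx pi B y); nra.
  apply/eqP; rewrite eq_complex; apply/andP; split; apply/eqP.
    exact: rz.
  (* Multiplication by ['i] is isometric and preserves the range, so it preserves the closure; this
     settles the imaginary part. *)
  have : rinner z (map_mx ( *:%R 'i%C) w) = 0.
    apply: rz => e e0; have [_ [y _ <-] h] := cw e e0.
    exists (rep_mx pi B (map_mx ( *:%R 'i%C) y)).
      by exists (map_mx ( *:%R 'i%C) y).
    apply: le_lt_trans h; rewrite rep_mx_scaler.
    rewrite !sqnormE; apply: ler_sum => i _; rewrite !mxE -scalerBr.
    rewrite innerZl innerZr mulrA.
    have -> : 'i%C * (('i%C)^*)%R = 1 :> R[i].
      apply/eqP; rewrite eq_complex.
      by apply/andP; split; apply/eqP => /=; ring.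
    by rewrite mul1r.
  by rewrite rinner_imZr.
have vvz : v - (v - z) = z by rewrite opprB addrC subrK.
have vz : orthproj (ranmx B) v = v - z.
  by apply: orthprojP => // w /zran; rewrite vvz.
by rewrite /= vz vvz; split.
Qed.

End RangeProjection.

(** * The variational formula for the rank *)

Section StateRank.
Variables (R : realType) (S : starAlgType R[i]) (H : hilbertType R).
Variables (pi : starRep S H) (xi : H) (tau : S -> R[i]).

(** The square of the Hilbert-Schmidt norm, for the trace with value n at the n by n identity. *)
Definition hsnorm n m (X : 'M[S]_(n, m)) : R :=
  complex.Re (tau (\tr (adjmx X *m X))).

Definition range_rank n m (B : 'M[S]_(n, m)) : R :=
  complex.Re (vector_state_mx xi (orthproj (ranmx pi B))).

(** Shared by the GNS representation of [A] and the restriction to [tcp act] of that of [B], so that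
    the rank is studied once for both. *)
Record tracial_rep : Prop := {
  tracial_repE : forall f, inner (pi f xi) xi = tau f;
  tracial_rep1 : tau 1 = 1;
  tracial_repC : forall f g, tau (f * g) = tau (g * f)
}.

Hypothesis pi_tau : tracial_rep.

Lemma tauD f g : tau (f + g) = tau f + tau g.
Proof. by rewrite -!(tracial_repE pi_tau) repD innerDl. Qed.

Lemma tauZ c f : tau (c *: f) = c * tau f.
Proof. by rewrite -!(tracial_repE pi_tau) repZ innerZl. Qed.

Lemma tauN f : tau (- f) = - tau f.
Proof. by rewrite -scaleN1r tauZ mulN1r. Qed.

Lemma tau0 : tau 0 = 0.
Proof. by rewrite -(scale0r (0 : S)) tauZ mul0r. Qed.

Lemma tau_sum I (r : seq I) (P : pred I) (F : I -> S) :
  tau (\sum_(i <- r | P i) F i) = \sum_(i <- r | P i) tau (F i).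
Proof. by apply: (big_morph tau) => [f g|]; [exact: tauD|exact: tau0]. Qed.

Lemma tauMn f k : tau (f *+ k) = tau f *+ k.
Proof. by elim: k => [|k IH]; rewrite ?mulr0n ?tau0// !mulrS tauD IH. Qed.

Lemma tau_star f : tau (star f) = ((tau f)^*)%R.
Proof. by rewrite -!(tracial_repE pi_tau) -innerC rep_star starK. Qed.

Lemma tau_trC n m (X : 'M[S]_(n, m)) (Y : 'M[S]_(m, n)) :
  tau (\tr (X *m Y)) = tau (\tr (Y *m X)).
Proof.
rewrite /mxtrace !tau_sum.
under eq_bigr do rewrite mxE tau_sum.
under [RHS]eq_bigr do rewrite mxE tau_sum.
rewrite exchange_big/=; apply: eq_bigr => j _; apply: eq_bigr => i _.
exact: tracial_repC.
Qed.

Lemma tau_tr1 n : tau (\tr (1%:M : 'M[S]_n)) = n%:R.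
Proof. by rewrite mxtrace1 tauMn (tracial_rep1 pi_tau). Qed.

Lemma hsnorm_adj n m (X : 'M[S]_(n, m)) : hsnorm (adjmx X) = hsnorm X.
Proof. by rewrite /hsnorm adjmxK tau_trC. Qed.

Lemma Re_tau_tr_adj n (X : 'M[S]_n) :
  complex.Re (tau (\tr (adjmx X))) = complex.Re (tau (\tr X)).
Proof.
rewrite -complexRe_conj -tau_star star_sum; congr (complex.Re (tau _)).
by apply: eq_bigr => i _; rewrite mxE starK.
Qed.

Lemma hsnormB n m (X Y : 'M[S]_(n, m)) : hsnorm (X - Y) =
  hsnorm X + hsnorm Y - 2 * complex.Re (tau (\tr (adjmx Y *m X))).
Proof.
rewrite /hsnorm adjmxB mulmxBl !mulmxBr.
rewrite !(linearB, tauD, tauN, raddfB, raddfD, raddfN)/=.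
rewrite -(Re_tau_tr_adj (adjmx X *m Y)) adjmxM adjmxK.
by ring.
Qed.

Definition basis_vec n (j : 'I_n) : 'cV[H]_n :=
  \col_k (if k == j then xi else 0).

Lemma rep_mx_basis_vec n m (X : 'M[S]_(n, m)) j :
  rep_mx pi X (basis_vec j) = \col_i pi (X i j) xi.
Proof.
apply/matrixP => i k; rewrite !mxE (bigD1 j)//= mxE eqxx big1 ?addr0// => l.
by move=> /negPf lj; rewrite mxE lj linear0.
Qed.

Lemma hsnormE n m (X : 'M[S]_(n, m)) :
  hsnorm X = \sum_j sqnorm (rep_mx pi X (basis_vec j)).
Proof.
rewrite /hsnorm /mxtrace tau_sum raddf_sum; apply: eq_bigr => j _ /=.
rewrite rep_mx_basis_vec sqnormE mxE tau_sum raddf_sum.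
apply: eq_bigr => i _ /=.
by rewrite !mxE -(tracial_repE pi_tau) repM rep_star starK.
Qed.

Lemma hsnorm_ge0 n m (X : 'M[S]_(n, m)) : 0 <= hsnorm X.
Proof. by rewrite hsnormE sumr_ge0// => j _; exact: sqnorm_ge0. Qed.

Lemma sqnorm_basis_vec n (j : 'I_n) : sqnorm (basis_vec j) = 1.
Proof.
rewrite sqnormE (bigD1 j)//= mxE eqxx big1 ?addr0 => [|i /negPf ij].
  by have := tracial_repE pi_tau 1; rewrite rep1 (tracial_rep1 pi_tau) => ->.
by rewrite mxE ij inner0l.
Qed.

Lemma range_rankE n m (B : 'M[S]_(n, m)) : range_rank B = 
  \sum_j rinner (orthproj (ranmx pi B) (basis_vec j)) (basis_vec j).
Proof.
rewrite /range_rank /vector_state_mx raddf_sum; apply: eq_bigr => j _ /=.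
rewrite /vector_state /rinner /cinner (bigD1 j)//= [in RHS]mxE eqxx.
rewrite big1 ?addr0// => i /negPf ij.
by rewrite [X in inner _ X]mxE ij innerC inner0l conjC0.
Qed.

(** Pythagoras in each column: for a basis vector v with projection p, |v - B Y v|^2 = |v - p|^2 +
    |p - B Y v|^2, and |v - p|^2 = 1 - <p, v>. *)
Lemma range_rank_ge n m (B : 'M[S]_(n, m)) (Y : 'M[S]_(m, n)) :
  n%:R - hsnorm (1%:M - B *m Y) <= range_rank B.
Proof.
rewrite range_rankE hsnormE -[n in n%:R]card_ord -sum1_card natr_sum -sumrB.
apply: ler_sum => j _; rewrite -(sqnorm_basis_vec j).
set v := basis_vec j; have [c _ /(_ v)] := damp_cvg pi B.
set p := orthproj _ v => -[Bp zp _].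
rewrite rep_mxB rep_mx1 rep_mxM; set y := rep_mx pi B _.
have By : ranmx pi B y by apply: subset_closure; exists (rep_mx pi Y v).
have -> : v - y = (v - p) + (p - y) by rewrite addrA subrK.
have zp0 : rinner (v - p) p = 0 by rewrite /rinner zp.
have zy0 : rinner (v - p) y = 0 by rewrite /rinner zp.
rewrite (sqnormD (v - p)) rinnerBr zp0 zy0 subr0 mulr0 addr0 (sqnormB v).
have vp : rinner v p = sqnorm p by apply/eqP; rewrite -subr_eq0 -rinnerBl zp0.
by rewrite (rinnerC p) vp; have := sqnorm_ge0 (p - y); lra.
Qed.

(** The bound of [range_rank_ge] is attained in the limit: the even powers of [damp] have the form 1
    - B Q and tend to v - p on every basis vector v. *)
Lemma range_rank_le n m (B : 'M[S]_(n, m)) (e : R) : 0 < e ->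
  exists c k, range_rank B <= n%:R - hsnorm (damp c B ^+ k) + e.
Proof.
move=> e0; have [c c0 hc] := damp_cvg pi B; exists c.
have n1 : 0 < n%:R + 1 :> R by rewrite ltr_wpDl.
have /fin_all_exists[N hN] : forall j : 'I_n, exists N, forall k, (N <= k)%N ->
    sqnorm (rep_mx pi (damp c B ^+ k.*2) (basis_vec j) -
      (basis_vec j - orthproj (ranmx pi B) (basis_vec j))) < e / (n%:R + 1).
  by move=> j; have [_ _] := hc (basis_vec j); apply; rewrite divr_gt0.
(* One exponent for all n columns, whose errors e / (n + 1) add up to at most e. *)
pose k := (\max_j N j)%N; exists k.*2.
rewrite range_rankE hsnormE -[n in n%:R]card_ord -sum1_card natr_sum -sumrB.
apply: le_trans (_ : \sum_(j < n) (1 - sqnorm (rep_mx pi (damp c B ^+ k.*2)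
    (basis_vec j)) + e / (n%:R + 1)) <= _); last first.
  rewrite big_split/= lerD2l sumr_const card_ord -[_ / _ *+ _]mulr_natl mulrCA.
  by rewrite ler_piMr ?ltW// ltr_pdivrMr// mul1r ltrDl.
apply: ler_sum => j _; have := sqnorm_basis_vec j.
have {hN} := hN j k (leq_bigmax j); have [] := hc (basis_vec j).
set v := basis_vec j; set p := orthproj _ v => Bp zp _.
have [Q ->] := damp_range c B k.*2; rewrite rep_mxB rep_mx1 rep_mxM.
set y := rep_mx pi B _.
have By : ranmx pi B y by apply: subset_closure; exists (rep_mx pi Q v).
have -> : v - y - (v - p) = p - y by rewrite opprB addrC addrA subrK.
have -> : v - y = (v - p) + (p - y) by rewrite addrA subrK.
have zp0 : rinner (v - p) p = 0 by rewrite /rinner zp.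
have zy0 : rinner (v - p) y = 0 by rewrite /rinner zp.
rewrite (sqnormD (v - p)) rinnerBr zp0 zy0 subr0 mulr0 addr0 (sqnormB v).
have vp : rinner v p = sqnorm p by apply/eqP; rewrite -subr_eq0 -rinnerBl zp0.
by rewrite (rinnerC p) vp; lra.
Qed.

(** By self-adjointness, [hsnorm] of a power of [damp] is the trace of the doubled power. As B and
    its adjoint share the same Q, traciality gives n - tr (1 - c B B^* )^2k = m - tr (1 - c B^*
    B)^2k, and the right side bounds the rank of the adjoint from below. *)
Lemma range_rank_le_adj n m (B : 'M[S]_(n, m)) :
  range_rank B <= range_rank (adjmx B).
Proof.
apply/ler_addgt0Pr => e e0; have [c [k hk]] := range_rank_le B e0.
apply: le_trans hk _; rewrite lerD2r.
have [Q' hQ'] := damp_range c (adjmx B) k.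
apply: le_trans (range_rank_ge (adjmx B) Q'); rewrite -hQ'.
rewrite /hsnorm !adjmxX !adjmx_damp -[_ *m _]/(_ * _).
rewrite -[(damp c (adjmx B) ^+ k) *m _]/(_ * _) -!exprD.
have [Q hQ hQ2] := exp_1sub_mulmx B (cscalemx c%:C (adjmx B)) (k + k).
rewrite {1}/damp hQ /damp adjmxK cscalemx_mulr -cscalemx_mull hQ2.
rewrite !(linearB, tauD, tauN, raddfB, raddfD, raddfN)/= !tau_tr1 tau_trC.
by rewrite !Re_natr; lra.
Qed.

Lemma range_rank_adj n m (B : 'M[S]_(n, m)) :
  range_rank (adjmx B) = range_rank B.
Proof.
apply/eqP; rewrite eq_le range_rank_le_adj andbT.
by have := range_rank_le_adj (adjmx B); rewrite adjmxK.
Qed.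

(** A candidate Q for B X yields the candidate X Q for B, with the same residual. *)
Lemma range_rankMl n m p (B : 'M[S]_(n, m)) (X : 'M[S]_(m, p)) :
  range_rank (B *m X) <= range_rank B.
Proof.
apply/ler_addgt0Pr => e e0; have [c [k hk]] := range_rank_le (B *m X) e0.
apply: le_trans hk _; rewrite lerD2r.
have [Q ->] := damp_range c (B *m X) k.
by rewrite -mulmxA; exact: range_rank_ge.
Qed.

Lemma range_rankMr n m p (B : 'M[S]_(n, m)) (X : 'M[S]_(m, p)) :
  range_rank (B *m X) <= range_rank X.
Proof.
by rewrite -range_rank_adj adjmxM -(range_rank_adj X); exact: range_rankMl.
Qed.

Lemma hsnorm1 n : hsnorm (1%:M : 'M[S]_n) = n%:R.
Proof. by rewrite /hsnorm adjmx1 mulmx1 tau_tr1 Re_natr. Qed.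

Lemma range_rank_ge0 n m (B : 'M[S]_(n, m)) : 0 <= range_rank B.
Proof.
by apply: le_trans (range_rank_ge B 0); rewrite mulmx0 subr0 hsnorm1 subrr.
Qed.

End StateRank.

(** * The coefficient algebra inside the crossed product *)

Section DiagonalCoefficient.
Variables (C : numClosedFieldType) (Gam : groupType) (A : starAlgType C).
Variable act : twistedAction Gam A.
Local Notation S := (tcp act).

Definition tdiag (a : A) : S := tsingle act a 1%g.
(** The conditional expectation, restricted to the algebraic crossed product. *)
Definition coefe (f : S) : A := tcoef f 1%g.

Fact tdiag_is_zmod_morphism : zmod_morphism tdiag.
Proof.
move=> a b; have hN : tdiag (- b) = - tdiag b.
  apply: (addrI (tdiag b)); rewrite -tsingleD !subrr; exact: tsingle0.
by rewrite -hN; exact: tsingleD.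
Qed.

Fact tdiag_is_monoid_morphism : monoid_morphism tdiag.
Proof.
split=> // a b; rewrite tmulE tmul_single tal1 tu1l mulr1 mulg1.
by [].
Qed.

HB.instance Definition _ :=
  GRing.isZmodMorphism.Build A S tdiag tdiag_is_zmod_morphism.
HB.instance Definition _ :=
  GRing.isMonoidMorphism.Build A S tdiag tdiag_is_monoid_morphism.

Fact coefe_is_zmod_morphism : zmod_morphism coefe.
Proof. by move=> f g; rewrite /coefe tcoefD [tcoef (- g) _]toppE. Qed.

HB.instance Definition _ :=
  GRing.isZmodMorphism.Build S A coefe coefe_is_zmod_morphism.

Lemma star_tdiag a : star (tdiag a) = tdiag (star a).
Proof.
rewrite [LHS]tstar_single invg1 tu1l star1 mul1r tal1.
by [].
Qed.

Lemma tdiag_mul_single a b s :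
  tdiag a * tsingle act b s = tsingle act (a * b) s.
Proof. by rewrite tmulE tmul_single tal1 tu1l mulr1 mul1g. Qed.

Lemma coefe_tdiag_mul a f : coefe (tdiag a * f) = a * coefe f.
Proof.
elim/tcp_ind: f => [|f g IH1 IH2|b s]; first by rewrite !mulr0 !raddf0 mulr0.
- by rewrite mulrDr !raddfD/= IH1 IH2 mulrDr.
rewrite tdiag_mul_single /coefe !tsingleE.
by case: ifP; rewrite ?mulr0.
Qed.

Lemma coefe_mul_tdiag f a : coefe (f * tdiag a) = coefe f * a.
Proof.
elim/tcp_ind: f => [|f g IH1 IH2|b s]; first by rewrite !mul0r !raddf0 mul0r.
- by rewrite mulrDl !raddfD/= IH1 IH2 mulrDl.
rewrite tmulE tmul_single tu1r mulr1 mulg1 /coefe !tsingleE.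
by case: eqP => [<-|]; rewrite ?mul0r// tal1.
Qed.

Local Notation dmx := (map_mx tdiag).
Local Notation cmx := (map_mx coefe).

Lemma cmx_mull n m p (X : 'M[A]_(n, m)) (Y : 'M[S]_(m, p)) :
  cmx (dmx X *m Y) = X *m cmx Y.
Proof.
apply/matrixP => i j; rewrite !mxE raddf_sum.
by apply: eq_bigr => k _; rewrite /= !mxE coefe_tdiag_mul.
Qed.

Lemma cmx_mulr n m p (X : 'M[S]_(n, m)) (Y : 'M[A]_(m, p)) :
  cmx (X *m dmx Y) = cmx X *m Y.
Proof.
apply/matrixP => i j; rewrite !mxE raddf_sum.
by apply: eq_bigr => k _; rewrite /= !mxE coefe_mul_tdiag.
Qed.

Lemma adjmx_dmx n m (X : 'M[A]_(n, m)) : adjmx (dmx X) = dmx (adjmx X).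
Proof. by apply/matrixP => i j; rewrite !mxE star_tdiag. Qed.

Lemma coefe_mxtrace n (X : 'M[S]_n) : coefe (\tr X) = \tr (cmx X).
Proof. by rewrite raddf_sum; apply: eq_bigr => i _; rewrite mxE. Qed.

End DiagonalCoefficient.

(** * Comparing ranks over the crossed product and over its coefficients *)

Section Transfer.
Variables (R : realType) (Gam : groupType) (A : starAlgType R[i]).
Variable act : twistedAction Gam A.
Local Notation S := (tcp act).
Variables (tr : A -> R[i]) (HA : hilbertType R) (piA : starRep A HA) (xiA : HA).
Hypothesis piA_tr : tracial_rep piA xiA tr.
Local Notation trS := (tr \o @coefe _ _ _ act).
Variables (HS : hilbertType R) (piS : starRep S HS) (xiS : HS).
Hypothesis piS_tr : tracial_rep piS xiS trS.
Local Notation dmx := (map_mx (@tdiag _ _ _ act)).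
Local Notation cmx := (map_mx (@coefe _ _ _ act)).
Local Notation rkA := (range_rank piA xiA).
Local Notation rkS := (range_rank piS xiS).
Local Notation hsA := (hsnorm tr).
Local Notation hsS := (hsnorm trS).

(* The model is the matrix whose rows are the s^bar e_j, for s in a set of [k]
   elements of the group: [W / sqrt k] is an isometry over [S], while the rows
   of [W] are orthonormal for the [A]-valued inner product given by [coefe]. *)
Record window k l n (W : 'M[S]_(l, n)) : Prop := {
  window_adjl : adjmx W *m W = 1%:M *+ k;
  window_adjr : cmx (W *m adjmx W) = 1%:M
}.

Lemma mxtraceMn l n (X : 'M[S]_n) : \tr (X *+ l) = \tr X *+ l.
Proof. exact: raddfMn. Qed.

Lemma mulmxMn_l l n m p (X : 'M[S]_(n, m)) (Y : 'M[S]_(m, p)) :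
  (X *+ l) *m Y = (X *m Y) *+ l.
Proof. exact: (raddfMn (mulmxr Y)). Qed.

Lemma mulmxMn_r l n m p (X : 'M[S]_(n, m)) (Y : 'M[S]_(m, p)) :
  X *m (Y *+ l) = (X *m Y) *+ l.
Proof. exact: (raddfMn (mulmx X)). Qed.

Lemma Re_tau_trMn l n (X : 'M[S]_n) :
  complex.Re (trS (\tr (X *+ l))) = l%:R * complex.Re (trS (\tr X)).
Proof.
by rewrite mxtraceMn (tauMn piS_tr) mulr_natl; exact: raddfMn.
Qed.

(** The trace of W W^* is l by [window_adjr], and that of W^* W is k n by [window_adjl]. *)
Lemma window_dim k l n (W : 'M[S]_(l, n)) : window k W ->
  l%:R = k%:R * n%:R :> R.
Proof.
case=> Wl Wr; have := tau_trC piS_tr W (adjmx W).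
rewrite Wl mxtraceMn (tauMn piS_tr) (tau_tr1 piS_tr).
rewrite [LHS]/= coefe_mxtrace Wr (tau_tr1 piA_tr) -[n%:R *+ k]mulr_natl.
by rewrite -natrM => /eqP; rewrite eqr_nat -natrM => /eqP ->.
Qed.

Lemma window_isometry k l n p (W : 'M[S]_(l, n)) (Z : 'M[A]_(l, p)) :
  window k W -> hsS (adjmx W *m dmx Z) = hsA Z.
Proof.
case=> _ Wr; rewrite /hsnorm adjmxM adjmxK adjmx_dmx mulmxA -(mulmxA _ W) /=.
by rewrite coefe_mxtrace cmx_mulr cmx_mull Wr mulmx1.
Qed.

(** This is |X - W^* c|^2 >= 0 for c = [cmx (W *m X)]: by [window_isometry] W^* c has the norm of c,
    and the cross term is |c|^2. *)
Lemma window_bessel k l n p (W : 'M[S]_(l, n)) (X : 'M[S]_(n, p)) :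
  window k W -> hsA (cmx (W *m X)) <= hsS X.
Proof.
move=> WW; have := hsnorm_ge0 piS_tr (X - adjmx W *m dmx (cmx (W *m X))).
rewrite (hsnormB piS_tr) (window_isometry _ WW) adjmxM adjmxK adjmx_dmx -mulmxA.
rewrite /= coefe_mxtrace cmx_mull -/(hsnorm tr _).
by lra.
Qed.

Lemma window_mul k l n p (W : 'M[S]_(l, n)) (X : 'M[S]_(n, p)) :
  window k W -> hsS (W *m X) = k%:R * hsS X.
Proof.
case=> Wl _; rewrite /hsnorm adjmxM -mulmxA (mulmxA (adjmx W)) Wl -Re_tau_trMn.
by rewrite mulmxMn_l mul1mx mulmxMn_r.
Qed.

(** The adjoint of the isometry W / sqrt k is a contraction; in squares this reads |k X - W W^* X|^2
    >= 0. *)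
Lemma window_adj_le k l n p (W : 'M[S]_(l, n)) (X : 'M[S]_(l, p)) :
  (0 < k)%N -> window k W -> hsS (adjmx W *m X) <= k%:R * hsS X.
Proof.
move=> k0 WW; have := hsnorm_ge0 piS_tr (X *+ k - W *m (adjmx W *m X)).
rewrite (hsnormB piS_tr).
have -> : hsS (X *+ k) = k%:R * (k%:R * hsS X).
  by rewrite /hsnorm adjmxMn mulmxMn_r mulmxMn_l !Re_tau_trMn.
have -> : hsS (W *m (adjmx W *m X)) = k%:R * hsS (adjmx W *m X).
  exact: window_mul.
have -> : complex.Re (trS (\tr (adjmx (W *m (adjmx W *m X)) *m (X *+ k)))) =
    k%:R * hsS (adjmx W *m X).
  by rewrite mulmxMn_r Re_tau_trMn /hsnorm !(adjmxM, adjmxK) !mulmxA.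
by have : 0 < k%:R :> R; [rewrite ltr0n | nra].
Qed.

(** For a candidate Y for M, the residual of the candidate for B is the image under [cmx] of W (1 -
    M Y) W^*. Bessel's inequality and [window_mul] bound its square norm by k |1 - M Y|^2, and l = k
    n matches the constant terms. *)
Lemma window_rank_ge k l p n m (W : 'M[S]_(l, n)) (W' : 'M[S]_(p, m))
    (M : 'M[S]_(n, m)) (B : 'M[A]_(l, p)) : window k W -> 
  W *m M = dmx B *m W' -> k%:R * rkS M <= rkA B.
Proof.
move=> WW WM; apply/ler_addgt0Pr => e e0.
have k1 : 0 < k%:R + 1 :> R by rewrite ltr_wpDl.
have [|c [i hi]] := range_rank_le piS_tr M (_ : 0 < e / (k%:R + 1)).
  by rewrite divr_gt0.
have [Y hY] := damp_range c M i; rewrite hY in hi.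
have : hsA (1%:M - B *m cmx (W' *m Y *m adjmx W)) <=
    k%:R * hsS (1%:M - M *m Y).
  have -> : 1%:M - B *m cmx (W' *m Y *m adjmx W) =
      cmx (W *m ((1%:M - M *m Y) *m adjmx W)).
    rewrite mulmxBl mul1mx mulmxBr raddfB/= (window_adjr WW) !mulmxA WM.
    by rewrite -!mulmxA cmx_mull.
  apply: le_trans (window_bessel _ WW) _.
  rewrite -(hsnorm_adj piS_tr) adjmxM adjmxK (window_mul _ WW).
  by rewrite (hsnorm_adj piS_tr).
have := range_rank_ge piA_tr B (cmx (W' *m Y *m adjmx W)).
rewrite (window_dim WW) => h1 h2.
have {}hi := ler_wpM2l (ler0n R k) hi.
have ke : k%:R * (e / (k%:R + 1)) <= e.
  by rewrite mulrCA ler_piMr ?ltW// ltr_pdivrMr// mul1r ltrDl.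
by rewrite mulrDr mulrBr in hi; lra.
Qed.

(* [Y] averages over the group elements s of the window [W'] the approximate
   solutions of [M^* Y = 1] obtained by translating by s the columns of [Z] that
   have index (s, _). *)
Lemma window_rank_le k l p n m (W : 'M[S]_(l, n)) (W' : 'M[S]_(p, m))
    (M : 'M[S]_(n, m)) (B : 'M[A]_(l, p)) : (0 < k)%N -> window k W' ->
  W *m M = dmx B *m W' -> rkA B <= k%:R * rkS M.
Proof.
move=> k0 WW WM; rewrite -(range_rank_adj piA_tr) -(range_rank_adj piS_tr).
have kp : 0 < k%:R :> R by rewrite ltr0n.
apply/ler_addgt0Pr => e e0.
have [c [i hi]] := range_rank_le piA_tr (adjmx B) e0.
have [Z hZ] := damp_range c (adjmx B) i; rewrite hZ in hi.
apply: le_trans hi _; rewrite lerD2r.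
have kC : (k%:R^-1 : R)%:C *+ k = 1.
  by rewrite -rmorphMn/= -mulr_natl mulfV ?gt_eqF.
set X := 1%:M - adjmx B *m Z.
pose Y := cscalemx (k%:R^-1 : R)%:C (adjmx W *m dmx Z *m W').
(* M^* W^* = W'^* B^*, and the identity is W'^* W' / k. *)
have hY : 1%:M - adjmx M *m Y =
    cscalemx (k%:R^-1 : R)%:C (adjmx W' *m dmx X *m W').
  rewrite cscalemx_mulr !mulmxA -adjmxM WM adjmxM adjmx_dmx.
  rewrite /X raddfB/= map_mx1 mulmxBr mulmx1 mulmxBl (window_adjl WW) cscalemxB.
  rewrite map_mxM !mulmxA; congr (_ - _).
  apply/matrixP => a b; rewrite [RHS]mxE mulmxnE -scalerMnr scalerMnl.
  by rewrite kC scale1r.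
have := range_rank_ge piS_tr (adjmx M) Y; rewrite hY.
have hz (N : 'M[S]_m) :
    hsS (cscalemx (k%:R^-1 : R)%:C N) = k%:R^-1 ^+ 2 * hsS N.
  rewrite (hsnormE piS_tr) (hsnormE piS_tr N) mulr_sumr.
  by apply: eq_bigr => a _; rewrite rep_mx_cscalemx sqnormZ.
rewrite hz => h1.
(* The left factor W'^* preserves the norm of X, and the right factor W' costs k. The k^-2 of [hz]
   and the k from p = k m cancel this cost. *)
have h2 : hsS (adjmx W' *m dmx X *m W') <= k%:R * hsA X.
  rewrite -(hsnorm_adj piS_tr) adjmxM.
  apply: le_trans (window_adj_le _ k0 WW) _; rewrite ler_pM2l//.
  by rewrite (hsnorm_adj piS_tr) (window_isometry _ WW).
rewrite (window_dim WW).
have := ler_wpM2l (ltW kp) h1; rewrite mulrBr; apply: le_trans.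
rewrite lerD2l lerN2 expr2 !mulrA mulfV ?gt_eqF// mul1r.
by rewrite ler_pdivrMl.
Qed.

End Transfer.

(** * Windows of finite sets and change of basis *)

Section ConcreteWindow.
Variables (C : numClosedFieldType) (Gam : groupType) (A : starAlgType C).
Variable act : twistedAction Gam A.
Local Notation S := (tcp act).
Local Notation dmx := (map_mx (@tdiag _ _ _ act)).
Local Notation cmx := (map_mx (@coefe _ _ _ act)).
Implicit Types F : {fset Gam}.

Lemma star_tsingle1_mul (s : Gam) :
  star (tsingle act 1 s) * tsingle act 1 s = 1.
Proof.
rewrite [star _]tstar_single tmulE tmul_single star1 !rmorph1 !mulr1 mulVg.
by rewrite tu_unitaryl.
Qed.

Lemma coefe_tsingle_star (s t : Gam) :
  @coefe _ _ _ act (tsingle act 1 s * star (tsingle act 1 t)) = (s == t)%:R.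
Proof.
rewrite [star _]tstar_single tmulE tmul_single /coefe tsingleE.
rewrite star1 rmorph1 mulr1 mul1r; have [<-|st] := eqVneq s t.
  (* The cocycle identity at (s, s^-1, s), where the other two factors are 1. *)
  have h : tal act s (tu act s^-1%g s) = tu act s s^-1%g.
    by have := tu_cocycle act s s^-1%g s; rewrite mulVg mulgV tu1r tu1l !mulr1.
  by rewrite mulgV eqxx tal_star h tu_unitaryl.
case: eqP => // /(congr1 (fun x => (x * t)%g)).
by rewrite mul1g -mulgA mulVg mulg1 => ts; rewrite ts eqxx in st.
Qed.

Definition fset_window F n : 'M[S]_(#|{: F * 'I_n}|, n) :=
  \matrix_(i, k) (let q := enum_val i in
    if q.2 == k then tsingle act 1 (val q.1) else 0).

Lemma fset_window_adjl F n :
  adjmx (fset_window F n) *m fset_window F n = 1%:M *+ #|` F|.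
Proof.
apply/matrixP => a b; rewrite mulmxnE !mxE.
pose G (q : F * 'I_n) : S := if (q.2 == a) && (a == b) then 1 else 0.
transitivity (\sum_(i < #|{: F * 'I_n}|) G (enum_val i)).
  apply: eq_bigr => i _; rewrite !mxE /G.
  case: eqP => [->|_] /=; last by rewrite star0 mul0r.
  by case: eqP; rewrite ?mulr0// star_tsingle1_mul.
rewrite -big_enum_val /G; under eq_bigl do rewrite inE.
rewrite -(pair_bigA _ (fun s k => if (k == a) && (a == b) then 1 else 0))/=.
rewrite (eq_bigr (fun=> (a == b)%:R)) => [|s _].
  by rewrite sumr_const cardfE.
rewrite (bigD1 a)//= eqxx big1 ?addr0 => [|k /negPf ->//].
by case: eqP.
Qed.

Lemma fset_window_adjr F n :
  cmx (fset_window F n *m adjmx (fset_window F n)) = 1%:M.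
Proof.
apply/matrixP => i i'; rewrite !mxE.
rewrite (bigD1 (enum_val i).2)//= big1 => [|k /negPf ik].
  rewrite addr0 !mxE /= eqxx; case: eqP => [ii|/eqP ii].
    rewrite coefe_tsingle_star; congr (_%:R); congr nat_of_bool.
    rewrite -(inj_eq enum_val_inj); apply/eqP/eqP => [|-> //].
    case: (enum_val i) (enum_val i') ii => [s a] [t b] /= -> st.
    by congr pair; exact: val_inj.
  rewrite star0 mulr0 raddf0; case: eqP => // e.
  by rewrite e eqxx in ii.
by rewrite !mxE /= eq_sym ik mul0r.
Qed.

Lemma approx_modP F f : approx_mod (act := act) F f <->
  exists a : Gam -> A, f = \sum_(s : F) tsingle act (a (val s)) (val s).
Proof.
by split=> -[a ->]; exists a; rewrite big_seq_fsetE.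
Qed.

Lemma approx_modD F f g : approx_mod (act := act) F f -> approx_mod F g ->
  approx_mod F (f + g).
Proof.
move=> [a ->] [b ->]; exists (a \+ b); rewrite -big_split.
by apply: eq_bigr => s _ /=; rewrite tsingleD.
Qed.

Lemma approx_mod0 F : approx_mod (act := act) F 0.
Proof. by exists (fun=> 0); rewrite big1// => s _; rewrite tsingle0. Qed.

Lemma row_mod_mulmx F F' n m (M : 'M[S]_(n, m)) x :
  (forall f i j, approx_mod F f -> approx_mod F' (f * M i j)) ->
  row_mod (approx_mod F) x -> row_mod (approx_mod F') (x *m M).
Proof.
move=> FM Fx j; rewrite mxE; apply: big_ind => [|f g|i _].
- exact: approx_mod0.
- exact: approx_modD.
- exact: FM.
Qed.

Lemma fset_window_row_mod F n x :
  row_mod (approx_mod (act := act) F) x <->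
  exists c, x = dmx c *m fset_window F n.
Proof.
have h (c : 'rV[A]_(#|{: F * 'I_n}|)) k : (dmx c *m fset_window F n) 0 k =
    \sum_(s : F) tsingle act (c 0 (enum_rank (s, k))) (val s).
  rewrite mxE.
  pose G (q : F * 'I_n) : S := if q.2 == k then
    tsingle act (c 0 (enum_rank (q.1, q.2))) (val q.1) else 0.
  transitivity (\sum_(i < #|{: F * 'I_n}|) G (enum_val i)).
    apply: eq_bigr => i _; rewrite !mxE /G -surjective_pairing enum_valK.
    by case: eqP; rewrite ?mulr0// tdiag_mul_single mulr1.
  rewrite -big_enum_val /G; under eq_bigl do rewrite inE.
  rewrite -(pair_bigA _ (fun s a => if a == k then
    tsingle act (c 0 (enum_rank (s, a))) (val s) else 0))/=.
  apply: eq_bigr => s _; rewrite (bigD1 k)//= eqxx big1 ?addr0// => a.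
  by move=> /negPf ->.
split=> [Fx|[c ->] k].
  have [a xa] := choice (fun k => (approx_modP F (x 0 k)).1 (Fx k)).
  exists (\row_i a (enum_val i).2 (val (enum_val i).1)).
  apply/rowP => k; rewrite h xa; apply: eq_bigr => s _.
  by rewrite mxE enum_rankK.
apply/approx_modP.
(* Coefficients are functions on the whole group; outside F they are set to 0. *)
exists (fun s => if insub s is Some t then c 0 (enum_rank (t, k)) else 0).
by rewrite h; apply: eq_bigr => s _; rewrite valK.
Qed.

Lemma fset_window_rows F n q (X : 'M[S]_(q, n)) :
  (forall i, row_mod (approx_mod F) (row i X)) ->
  exists D, X = dmx D *m fset_window F n.
Proof.
move=> FX; have [c Xc] := choice (fun i => (fset_window_row_mod F _).1 (FX i)).
exists (\matrix_i c i); apply/row_matrixP => i.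
by rewrite row_mul -map_row rowK Xc.
Qed.

Lemma left_combE n l (c : 'rV[A]_l) (w : 'I_l -> 'rV[S]_n) :
  left_comb c w = dmx c *m \matrix_i w i.
Proof.
by rewrite mulmx_sum_row; apply: eq_bigr => i _; rewrite mxE rowK.
Qed.

Lemma fset_window_basis F n :
  row_basis (row_mod (approx_mod F)) (fun i => row i (fset_window F n)).
Proof.
have rowW : \matrix_i row i (fset_window F n) = fset_window F n.
  by apply/row_matrixP => i; rewrite rowK.
split=> [i|x /fset_window_row_mod[c ->]].
  apply/fset_window_row_mod; exists (row i 1%:M).
  by rewrite map_row map_mx1 -row_mul mul1mx.
exists c; split=> [|d]; rewrite left_combE rowW//.
(* Orthonormality of the rows recovers the coordinates. *)
move=> /(congr1 (fun z => cmx (z *m adjmx (fset_window F n)))).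
by rewrite -!mulmxA !cmx_mull fset_window_adjr !mulmx1.
Qed.

(** Lets ranks computed in arbitrary bases be compared with those computed in windows. T D = 1
    because the rows of both sides are coordinates of the w_i, which are unique. *)
Lemma row_basis_matrix F n l (w : 'I_l -> 'rV[S]_n) :
  row_basis (row_mod (approx_mod F)) w -> exists D T,
  [/\ fset_window F n = dmx D *m \matrix_i w i,
      \matrix_i w i = dmx T *m fset_window F n & T *m D = 1%:M].
Proof.
move=> [wF wB].
have [T hC] : exists T, \matrix_i w i = dmx T *m fset_window F n.
  by apply: fset_window_rows => i; rewrite rowK.
have [d hd] := choice (fun i => wB _ ((fset_window_basis F n).1 i)).
pose D := \matrix_i d i; exists D, T.
have hD : fset_window F n = dmx D *m \matrix_i w i.
  apply/row_matrixP => i; rewrite row_mul -map_row rowK -left_combE.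
  by have [] := hd i.
split=> //; apply/row_matrixP => i.
have [e [_ we]] := wB _ (wF i).
rewrite -(we (row i (T *m D))) ?left_combE.
  apply: we; rewrite left_combE map_row map_mx1 -row_mul mul1mx rowK//.
by rewrite map_row -row_mul map_mxM -mulmxA -hD -hC rowK.
Qed.

End ConcreteWindow.

(** * Bounds on the approximating ranks and their limit *)

Section RankAtBounds.
Variables (R : realType) (Gam : groupType) (A : starAlgType R[i]).
Variable act : twistedAction Gam A.
Local Notation S := (tcp act).
Variables (tr : A -> R[i]) (HA : hilbertType R) (piA : starRep A HA) (xiA : HA).
Hypothesis piA_tr : tracial_rep piA xiA tr.
Variables (HS : hilbertType R) (piS : starRep S HS) (xiS : HS).
Hypothesis piS_tr : tracial_rep piS xiS (tr \o @coefe _ _ _ act).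
Local Notation rkA := (range_rank piA xiA).
Local Notation rkS := (range_rank piS xiS).

Lemma fset_windowP (F : {fset Gam}) n : window #|` F| (fset_window act F n).
Proof.
by split; [exact: fset_window_adjl|exact: fset_window_adjr].
Qed.

Lemma fset_window_rep (F F' : {fset Gam}) n m (M : 'M[S]_(n, m)) :
  (forall f i j, approx_mod F f -> approx_mod F' (f * M i j)) ->
  exists B, fset_window act F n *m M =
    map_mx (@tdiag _ _ _ act) B *m fset_window act F' m.
Proof.
move=> FM; apply: fset_window_rows => i; rewrite row_mul.
by apply: row_mod_mulmx FM _; have [+ _] := fset_window_basis act F n; apply.
Qed.

(** In window bases the matrix of M is D B T', of rank at most that of B. *)
Lemma is_rank_at_ge n m (M : 'M[S]_(n, m)) F r :
  is_rank_at rkA M F r -> #|` F|%:R * rkS M <= r.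
Proof.
move=> [F' [l [p [w [w' [B [FM wB wB' wM ->]]]]]]].
have [D [T [hD hT _]]] := row_basis_matrix wB.
have [D' [T' [hD' hT' _]]] := row_basis_matrix wB'.
apply: le_trans (range_rankMr piA_tr D _).
apply: le_trans (range_rankMl piA_tr (D *m B) T').
apply: (window_rank_ge piA_tr piS_tr (fset_windowP F n)
  (W' := fset_window act (val F') m)).
rewrite !map_mxM -!mulmxA -hT' hD -mulmxA; congr (_ *m _).
apply/row_matrixP => i; rewrite !row_mul rowK wM left_combE.
by rewrite map_row.
Qed.

(** The target F'' is independent of the one used for B. Both contain the image, so B factors
    through the window matrix B0 of M with values in F''. *)
Lemma is_rank_at_le n m (M : 'M[S]_(n, m)) F (F'' : {fset Gam}) r :
  F'' != fset0 ->
  (forall f i j, approx_mod F f -> approx_mod F'' (f * M i j)) ->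
  is_rank_at rkA M F r -> r <= #|` F''|%:R * rkS M.
Proof.
move=> F0 FM'' [F' [l [p [w [w' [B [FM wB wB' wM ->]]]]]]].
have [D [T [hD hT _]]] := row_basis_matrix wB.
have [D' [T' [hD' hT' TD']]] := row_basis_matrix wB'.
have [B0 hB0] := fset_window_rep FM''.
have wMB : \matrix_i w i *m M = map_mx (@tdiag _ _ _ act) B *m \matrix_i w' i.
  by apply/row_matrixP => i; rewrite !row_mul rowK wM left_combE map_row.
(* In T B0 W'' = B T' W', pairing with W' removes W', and T' D' = 1 removes T'. *)
have hB : B = T *m B0 *m map_mx (@coefe _ _ _ act) (fset_window act F'' m *m
    adjmx (fset_window act (val F') m)) *m D'.
  rewrite -[LHS]mulmx1 -TD' mulmxA; congr (_ *m _).
  have /(congr1 (fun z => map_mx (@coefe _ _ _ act)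
      (z *m adjmx (fset_window act (val F') m)))) := wMB.
  rewrite hT hT' -!mulmxA [X in _ *m X]mulmxA hB0 -!mulmxA !cmx_mull.
  by rewrite fset_window_adjr mulmx1 => ->.
rewrite hB; apply: le_trans (range_rankMl piA_tr _ _) _.
apply: le_trans (range_rankMl piA_tr _ _) _.
apply: le_trans (range_rankMr piA_tr _ _) _.
apply: (window_rank_le piA_tr piS_tr _ (fset_windowP F'' m) hB0).
by rewrite cardfs_gt0.
Qed.

Lemma is_rank_at_ex n m (M : 'M[S]_(n, m)) F (F'' : {fset Gam}) :
  F'' != fset0 ->
  (forall f i j, approx_mod F f -> approx_mod F'' (f * M i j)) ->
  exists r, is_rank_at rkA M F r.
Proof.
move=> F0 FM; have [B hB] := fset_window_rep FM.
exists (rkA B), (exist _ F'' F0), _, _, (fun i => row i (fset_window act F n)),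
  (fun i => row i (fset_window act F'' m)), B; split => //.
- exact: fset_window_basis.
- exact: fset_window_basis.
move=> i; rewrite left_combE -row_mul hB row_mul map_row; congr (_ *m _).
by apply/row_matrixP => k; rewrite rowK.
Qed.

Lemma rank_at_bounds n m (M : 'M[S]_(n, m)) F (F'' : {fset Gam}) :
  F'' != fset0 ->
  (forall f i j, approx_mod F f -> approx_mod F'' (f * M i j)) ->
  #|` F|%:R * rkS M <= rank_at rkA M F <= #|` F''|%:R * rkS M.
Proof.
move=> F0 FM; have [r hr] := is_rank_at_ex F0 FM.
(* A value exists, so [xget] does not fall back on 0. *)
rewrite /rank_at; case: xgetP => [q _ hq|/(_ r)]; last by case.
by rewrite (is_rank_at_ge hq) (is_rank_at_le F0 FM hq).
Qed.

Lemma invariant_modP (V : {fset S}) (e : R) (F : {fset Gam}) :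
  F != fset0 -> invariant_mod V e F -> exists F' : {fset Gam},
  [/\ F' != fset0, (#|` F'|)%:R <= (1 + e) * #|` F|%:R
    & forall f x, approx_mod F f -> x \in V -> approx_mod F' (f * x)].
Proof.
move=> F0 [F' [sF' dF']]; exists F'; split=> //; last first.
  move=> f x Ff xV; rewrite -[f * x]add0r; apply: sF' => /=.
  exists 0; first exact: approx_mod0.
  exists (f * x); last by [].
  by exists 1%N, (fun=> f), (fun=> x); split => //; rewrite big_ord1.
(* For s in F, the element s^bar + 0 lies in the module of F', which excludes an empty F'. *)
apply/eqP => F'0; have [s sF] := fset0Pn _ F0.
have : approx_mod F' (tsingle act 1 s).
  rewrite -[tsingle _ _ _]addr0; apply: sF' => /=.
  exists (tsingle act 1 s).
    exists (fun t => if t == s then 1 else 0).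
    rewrite (big_fsetD1 s)//= eqxx big_seq big1 ?addr0// => t.
    by rewrite !inE => /andP[/negPf -> _]; rewrite tsingle0.
  exists 0 => //; exists 0%N, (fun=> 0), (fun=> 0).
  by split=> [[]|[]|]//; rewrite big_ord0.
move=> [a]; rewrite F'0 big_seq_fset0 => /(congr1 (fun f => tcoef f s)).
by rewrite tsingleE eqxx tcoef0 => /eqP; rewrite oner_eq0.
Qed.

Lemma rank_approxE (omega : set_system (approx_sys Gam)) :
  ProperFilter omega ->
  (forall (V : {fset S}) (e : R), 0 < e ->
      omega [set F | invariant_mod V e (val F)]) ->
  forall n m (M : 'M[S]_(n, m)), rank_approx rkA omega M = rkS M.
Proof.
move=> omega_proper omega_inv n m M; apply/cvg_lim => //.
apply/cvgrPdist_le => e e0.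
have r0 := range_rank_ge0 piS_tr M.
have r1 : 0 < rkS M + 1 by rewrite ltr_wpDl.
(* Invariance under the entries of M up to e / (rk M + 1) places the quotient between rk M and rk M
   + e. *)
have := omega_inv [fset M i j | i in 'I_n, j in 'I_m]%fset _ (divr_gt0 e0 r1).
apply: filterS => -[F F0] /= /(invariant_modP F0)[F' [F'0 dF' FM]].
have {FM}/(rank_at_bounds F'0)/andP[h1 h2] :
    forall f i j, approx_mod F f -> approx_mod F' (f * M i j).
  move=> f i j Ff; apply: FM => //; apply/imfset2P.
  by exists i => //; exists j.
have c0 : 0 < #|` F|%:R :> R by rewrite ltr0n cardfs_gt0.
rewrite distrC ger0_norm ?subr_ge0 ?ler_pdivlMr ?[_ * #|` _|%:R]mulrC//.
rewrite lerBlDr ler_pdivrMr//; apply: le_trans h2 _.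
apply: le_trans (ler_wpM2r r0 dF') _.
rewrite mulrAC ler_pM2r// mulrDl mul1r addrC lerD2r mulrAC.
by rewrite ler_pdivrMr// ler_pM2l// lerDl.
Qed.

End RankAtBounds.

(** * The trace of the crossed product *)

Section CrossedProductTrace.
Variables (C : numClosedFieldType) (Gam : groupType) (A : starAlgType C).
Variables (act : twistedAction Gam A) (tr : A -> C).
Hypothesis tr_tracial : tracial_state tr.
Hypothesis tr_invariant : forall s a, tr (tal act s a) = tr a.

Let trD a b : tr (a + b) = tr a + tr b.
Proof. by have := trace_linear tr_tracial 1 a b; rewrite !scale1r mul1r. Qed.

(** For a s^bar and b t^bar both coefficients vanish unless t = s^-1. In that case invariance allows
    applying [tal act s] inside the second trace, the cocycle identity cancels the unitaries, and
    traciality of [tr] concludes. *)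
Lemma trace_coefeC (f g : tcp act) : tr (coefe (f * g)) = tr (coefe (g * f)).
Proof.
elim/tcp_ind: f => [|f1 f2 IH1 IH2|a s]; first by rewrite mul0r mulr0.
- by rewrite mulrDl mulrDr !raddfD/= !trD IH1 IH2.
elim/tcp_ind: g => [|g1 g2 IH1 IH2|b t]; first by rewrite mul0r mulr0.
- by rewrite mulrDl mulrDr !raddfD/= !trD IH1 IH2.
rewrite !tmulE !tmul_single /coefe !tsingleE.
have [->|ts] := eqVneq t s^-1%g; last first.
  have st : (1 == s * t)%g = false.
    apply/eqP => h; have := congr1 (fun x => (s^-1 * x)%g) h.
    by rewrite mulg1 mulKg => /esym/eqP; rewrite (negPf ts).
  rewrite st; case: eqP => // h.
  have := congr1 (fun x => (x * s^-1)%g) h.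
  by rewrite mul1g mulgK => /esym/eqP; rewrite (negPf ts).
rewrite mulgV mulVg eqxx -[RHS](tr_invariant s) !rmorphM/= talM mulgV tal1.
have -> : tal act s (tu act s^-1%g s) = tu act s s^-1%g.
  by have := tu_cocycle act s s^-1%g s; rewrite mulVg mulgV tu1r tu1l !mulr1.
rewrite -!mulrA tu_unitaryl mulr1 mulrA (traceC tr_tracial).
by rewrite [RHS](traceC tr_tracial) -!mulrA.
Qed.

End CrossedProductTrace.

(** * Restricting representations along a star homomorphism *)

Section PullbackRep.
Variables (R : realType) (S B : starAlgType R[i]) (iota : {lrmorphism S -> B}).
Hypothesis iota_star : forall f, iota (star f) = star (iota f).
Variables (H : hilbertType R) (pi : starRep B H).

(** Expresses the rank over [B] of the image of M as a [range_rank] of M itself, with candidates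
    taken in the algebraic crossed product. *)
Program Definition pullback_rep : starRep S H :=
  {| rep := fun f => pi (iota f) |}.
Next Obligation. by move=> f; exact: (rep_linear pi (iota f)). Qed.
Next Obligation. by move=> f; have := @rep_continuous _ _ _ pi (iota f). Qed.
Next Obligation. by move=> f g x /=; rewrite rmorphD repD. Qed.
Next Obligation. by move=> c f x /=; rewrite linearZ repZ. Qed.
Next Obligation. by move=> x /=; rewrite rmorph1 rep1. Qed.
Next Obligation. by move=> f g x /=; rewrite rmorphM repM. Qed.
Next Obligation. by move=> f x y /=; rewrite iota_star rep_star. Qed.

End PullbackRep.

(** * Equality of the two ranks *)

Theorem theorem1p3 (R : realType) (Gam : groupType) (A : cstarAlgType R)
    (act : twistedAction Gam A) (tr : A -> R[i])
    (Gam_amenable : amenable R Gam)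
    (tr_tracial : tracial_state tr)
    (tr_invariant : forall s a, tr (tal act s a) = tr a)
    (B : cstarAlgType R) (iota : {lrmorphism tcp act -> B})
    (B_max : max_crossed_product iota)
    (E : B -> A) (E_cond : cond_expectation iota E)
    (Gtr : gns tr) (GtrB : gns (tr \o E))
    (omega : set_system (approx_sys Gam)) (omega_ultra : UltraFilter omega)
    (omega_inv : forall (V : {fset tcp act}) (e : R), 0 < e ->
      omega [set F | invariant_mod V e (val F)])
    (n m : nat) (M : 'M[tcp act]_(n, m)) :
  vn_rank GtrB (map_mx iota M) = rank_approx (@vn_rank R A tr Gtr) omega M.
Proof.
(* Both sides are additive, so it suffices to compare them on the elements a s^bar. *)
have Eiota f : E (iota f) = coefe f.
  pose EL := GRing.isLinear.Build _ _ _ _ E (ce_linear E_cond).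
  pose E' : {linear B -> A} := HB.pack E EL.
  elim/tcp_ind: f => [|f g IH1 IH2|a s].
  - by rewrite !raddf0; exact: (raddf0 E').
  - by rewrite !raddfD/= -IH1 -IH2; exact: (raddfD E').
  rewrite /coefe tsingleE; case: eqVneq => [<-|s1].
    exact: ce_diag.
  by rewrite (ce_offdiag E_cond)// eq_sym.
have trA : tracial_rep (gns_rep Gtr) (gns_vec Gtr) tr.
  by split; [exact: gns_state|exact: trace1|exact: traceC].
pose piS := pullback_rep (mcp_star B_max) (gns_rep GtrB).
have trS : tracial_rep piS (gns_vec GtrB) (tr \o @coefe _ _ _ act).
  split=> [f||f g] /=.
  - by rewrite gns_state /= Eiota.
  - by rewrite /coefe tsingleE eqxx trace1.
  - exact: trace_coefeC.
have omega_proper : ProperFilter omega by exact: ultra_proper.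
rewrite (rank_approxE trA trS omega_proper omega_inv).
rewrite /vn_rank.
(* Both ranks evaluate, at the same vector, the projection on the closure of the same range. *)
suff -> : rep_mx (gns_rep GtrB) (map_mx iota M) = rep_mx piS M by [].
apply/funext => v; apply/matrixP => i j; rewrite !mxE.
by apply: eq_bigr => k _; rewrite mxE.
Qed.
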